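(* For every $\beta>0$ and every probability measure $\alpha$ on $E=\{-1,0,1\}$ there exists a time $t_0(\beta,\alpha)>0$ such that for every Gibbs measure $\mu\in\mathcal G(\gamma^{sc}_{\beta,\alpha})$ of the soft-core Widom-Rowlinson model on $\mathbb Z^d$ the time-evolved measure $\mu_t$ is a Gibbs measure for all times $0<t<t_0(\beta,\alpha)$.
   Context: Let $\Omega=E^{\mathbb Z^d}$ with product $\sigma$-algebra $\mathcal F$; for $\Lambda\subset\mathbb Z^d$ let $\mathcal F_\Lambda$ be the $\sigma$-algebra generated by the coordinates in $\Lambda$, and $\Lambda^c=\mathbb Z^d\setminus\Lambda$. Write $i\sim j$ if $\|i-j\|_1=1$, and for finite $\Lambda$ let $\mathcal E^b_\Lambda=\{\{i,j\}: i\sim j,\ \{i,j\}\cap\Lambda\ne\emptyset\}$. A function is local if it is $\mathcal F_\Lambda$-measurable for some finite $\Lambda$, and quasilocal if it is a uniform limit of local functions. A specification $\gamma=(\gamma_\Lambda)$, indexed by finite $\Lambda$, is a family of probability kernels from $\mathcal F_{\Lambda^c}$ to $\mathcal F$ with $\gamma_\Lambda(B|\cdot)=\mathbf 1_B$ for $B\in\mathcal F_{\Lambda^c}$ and $\gamma_\Lambda(\gamma_\Delta(A|\cdot)|\omega)=\gamma_\Lambda(A|\omega)$ for $\Delta\subset\Lambda$, $A\in\mathcal F$; it is quasilocal if $\gamma_\Lambda(f|\cdot)$ is quasilocal for each finite $\Lambda$ and quasilocal $f$. A probability measure $\mu$ is admitted by $\gamma$ if $\mu(A|\mathcal F_{\Lambda^c})=\gamma_\Lambda(A|\cdot)$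 $\mu$-a.s. for all finite $\Lambda$, $A\in\mathcal F$; $\mathcal G(\gamma)$ is the set of such measures when $\gamma$ is quasilocal. A probability measure is called a Gibbs measure if it is admitted by some quasilocal specification. The soft-core specification is $\gamma^{sc}_{\Lambda,\beta,\alpha}(\omega|\eta)=\frac1{Z_\eta}\exp\big(-\beta\sum_{\{i,j\}\in\mathcal E^b_\Lambda}\mathbf 1(\xi_i\xi_j=-1)\big)\prod_{i\in\Lambda}\alpha(\omega_i)$ with $\xi=\omega_\Lambda\eta_{\Lambda^c}$ and $Z_\eta$ the normalization. Time evolution: for $a,b\in E$, $t>0$, $$p_t(a,b)=\tfrac12(1+e^{-2t})\mathbf 1_{a=b\ne0}+\tfrac12(1-e^{-2t})\mathbf 1_{ab=-1}+\mathbf 1_{a=b=0},$$ $p_t(\omega,d\eta)=\prod_{i}p_t(\omega_i,d\eta_i)$, and $\mu_t(f)=\int\int f(\eta)\,p_t(\omega,d\eta)\,\mu(d\omega)$. *)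

(* Defs.v *)
From HB Require Import structures.
From mathcomp Require Import all_boot all_order all_algebra finmap.
From mathcomp Require Import zify ring lra.
From mathcomp Require Import all_classical all_reals all_analysis.
From mathcomp Require Import measurable_realfun.

Set Implicit Arguments.
Unset Strict Implicit.
Unset Printing Implicit Defensive.

Import Order.TTheory GRing.Theory Num.Theory.
Import numFieldNormedType.Exports.

Local Open Scope classical_set_scope.
Local Open Scope ring_scope.

(* The single-site space E = {-1, 0, 1}, as a subtype of int, with the discrete
   sigma-algebra. *)
Definition spin : Type := seq_sub [:: -1; 0; 1 : int].
HB.instance Definition _ := Finite.on spin.
HB.instance Definition _ := isPointed.Build spin (SeqSub (mem_head _ _)).
HB.instance Definition _ := @isMeasurable.Build default_measure_display spin
  discrete_measurable discrete_measurable0 discrete_measurableC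
  discrete_measurableU.

Definition spin_val (a : spin) : int := ssval a.

Lemma spin_minus_subproof : (-1 : int) \in [:: -1; 0; 1 : int]. Proof. by []. Qed.
Lemma spin_zero_subproof : (0 : int) \in [:: -1; 0; 1 : int]. Proof. by []. Qed.
Lemma spin_plus_subproof : (1 : int) \in [:: -1; 0; 1 : int]. Proof. by []. Qed.
Definition spin_minus : spin := SeqSub spin_minus_subproof.
Definition spin_zero : spin := SeqSub spin_zero_subproof.
Definition spin_plus : spin := SeqSub spin_plus_subproof.

Lemma spinP (a : spin) : [\/ a = spin_minus, a = spin_zero | a = spin_plus].
Proof.
have : ssval a \in [:: -1; 0; 1 : int] := ssvalP a.
rewrite !inE => /or3P[]/eqP ae.
- by constructor 1; exact: val_inj.
- by constructor 2; exact: val_inj.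
- by constructor 3; exact: val_inj.
Qed.

Lemma big_spin (T : Type) (idx : T) (op : Monoid.com_law idx) (F : spin -> T) :
  \big[op/idx]_a F a = op (F spin_minus) (op (F spin_zero) (F spin_plus)).
Proof.
rewrite (bigD1 spin_minus)//= (bigD1 spin_zero)//= (bigD1 spin_plus)//=.
rewrite big1 ?Monoid.mulm1// => a.
by case: (spinP a) => ->.
Qed.

Definition site (d : nat) : Type := 'rV[int]_d.
HB.instance Definition _ d := Countable.on (site d).

Definition neighbors d (i j : site d) : bool :=
  \sum_(k < d) `|i ord0 k - j ord0 k| == 1.

Definition cylinders d (J : set (site d)) : set (set (site d -> spin)) :=
  [set A | exists2 i, J i & exists B : set spin, A = [set w | B (w i)]].

(* E^(Z^d) equipped with the sigma-algebra F_J generated by the coordinates in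
   J; all these types are convertible, and [config d] carries the full product
   sigma-algebra F. *)
Definition sigma_field d (J : set (site d)) :
    measurableType (cylinders J).-sigma :=
  g_sigma_algebraType (cylinders J).

Definition config d := sigma_field [set: site d].

Section gibbs.
Context {R : realType} (d : nat).

Definition local_function (f : config d -> R) : Prop :=
  exists L : {fset site d},
    measurable_fun [set: sigma_field [set` L]] (f : sigma_field [set` L] -> R).

Definition quasilocal_function (f : config d -> R) : Prop :=
  exists g : nat -> config d -> R,
    (forall n, local_function (g n)) /\ {uniform, g @ \oo --> f}.

Definition kernel_family := {fset site d} -> config d -> probability (config d) R.

Definition is_specification (g : kernel_family) : Prop :=
  [/\ forall (L : {fset site d}) A, measurable A ->
        measurable_fun [set: sigma_field (~` [set` L])] (fun w => g L w A),
      forall (L : {fset site d}) (B : set (sigma_field (~` [set` L]))) w,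
        measurable B ->
        g L w B = (\1_B w)%:E &
      forall (D L : {fset site d}) A w, (D `<=` L)%fset -> measurable A ->
        (\int[g L w]_x g D x A)%E = g L w A].

Definition quasilocal (g : kernel_family) : Prop :=
  forall L (f : config d -> R), quasilocal_function f ->
    quasilocal_function (fun w => \int[g L w]_x f x).

(* g is a version of mu(A | F_J). *)
Definition is_conditional_probability (mu : probability (config d) R)
    (J : set (site d)) (A : set (config d)) (g : config d -> \bar R) : Prop :=
  measurable_fun [set: sigma_field J] (g : sigma_field J -> \bar R) /\
  forall B : set (sigma_field J), measurable B ->
    (\int[mu]_(w in B) g w)%E = mu (A `&` B).

Definition admitted (g : kernel_family) (mu : probability (config d) R) : Prop :=
  forall (L : {fset site d}) A, measurable A ->
    is_conditional_probability mu (~` [set` L]) A (fun w => g L w A).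

Definition gibbs_measures (g : kernel_family) : set (probability (config d) R) :=
  [set mu | admitted g mu].

Definition is_gibbs (mu : probability (config d) R) : Prop :=
  exists g, [/\ is_specification g, quasilocal g & admitted g mu].
End gibbs.
Arguments kernel_family : clear implicits.

(* The set E^b_L of bonds touching L; a bond is an unordered pair of sites. *)
Definition interaction_bonds d (L : {fset site d}) : set {fset site d} :=
  [set b | exists i j : site d, [/\ b = [fset i; j]%fset, neighbors i j &
    i \in L \/ j \in L]].

Lemma neighborsP d (i j : site d) : neighbors i j ->
  exists k : 'I_d, exists b : bool, j = i + (if b then 1 else -1) *: delta_mx ord0 k.
Proof.
rewrite /neighbors => /eqP ij.
have [k ijk] : exists k, i ord0 k != j ord0 k.
  apply/existsP; apply: contra_eqT ij => /existsPn h.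
  by rewrite big1// => k _; have := h k; rewrite negbK => /eqP ->; rewrite subrr.
move: ij; rewrite (bigD1 k)//= => ij.
have : 1 <= `|i ord0 k - j ord0 k| by rewrite -gtz0_ge1 normr_gt0 subr_eq0.
have : 0 <= \sum_(l | l != k) `|i ord0 l - j ord0 l| by exact: sumr_ge0.
have split1 (m n : int) : n + m = 1 -> 0 <= m -> 1 <= n -> n = 1 /\ m = 0.
  by lia.
move=> s0 n1; have [ijk1 s1] := split1 _ _ ij s0 n1.
have off l : l != k -> j ord0 l = i ord0 l.
  move=> lk; move/eqP: s1; rewrite psumr_eq0// => /allP/(_ l).
  by rewrite mem_index_enum lk/= normr_eq0 subr_eq0 => /(_ isT)/eqP.
exists k, (i ord0 k < j ord0 k); apply/rowP => l; rewrite !mxE eqxx/=.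
case: (eqVneq l k) => [->|lk]; last by rewrite (off _ lk) mulr0 addr0.
by move: ijk1; move: (i ord0 k) (j ord0 k) => m n; case: ifPn => h; lia.
Qed.

Lemma finite_interaction_bonds d (L : {fset site d}) :
  finite_set (interaction_bonds L).
Proof.
pose nb (i : site d) (u : 'I_d * bool) : {fset site d} :=
  [fset i; (i + (if u.2 then 1 else -1) *: delta_mx ord0 u.1)%R]%fset.
apply: (@sub_finite_set _ _ [set nb x.1 x.2 | x in [set` L] `*` setT]).
  move=> _ [i [j [-> ij [iL|jL]]]].
    have [k [b jE]] := neighborsP ij.
    by exists (i, (k, b)) => //=; rewrite /nb jE.
  have [k [b iE]] : exists k : 'I_d, exists b : bool,
      i = j + (if b then 1 else -1) *: delta_mx ord0 k.
    apply: neighborsP; move: ij; rewrite /neighbors.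
    by under eq_bigr do rewrite distrC.
  by exists (j, (k, b)) => //=; rewrite /nb/= -iE fsetUC.
apply: finite_image; apply: finite_setX => //; exact: finite_finset.
Qed.

(* w on L, eta off L *)
Definition concat_config d (L : {fset site d}) (w : {ffun L -> spin})
    (eta : config d) : config d :=
  fun i => oapp w (eta i) (insub i).

Section softcore.
Context {R : realType} (d : nat) (beta : R) (alpha : probability spin R).

(* For a bond b = {i, j}, the product below is xi_i * xi_j. *)
Definition repulsion (b : {fset site d}) (xi : config d) : R :=
  (\prod_(i <- b) spin_val (xi i) == -1)%:R.

Definition softcore_weight (L : {fset site d}) (eta : config d)
    (w : {ffun L -> spin}) : R :=
  let xi := concat_config w eta in
  expR (- beta * \sum_(b \in interaction_bonds L) repulsion b xi) *
  \prod_(i : L) fine (alpha [set w i]).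

Definition softcore_partition (L : {fset site d}) (eta : config d) : R :=
  \sum_(w : {ffun L -> spin}) softcore_weight eta w.

Definition softcore (L : {fset site d}) (eta : config d)
    (A : set (config d)) : \bar R :=
  (\sum_(w : {ffun L -> spin})
    (softcore_weight eta w / softcore_partition L eta)%:E *
    \d_(concat_config w eta) A)%E.

Lemma softcore_weight_ge0 (L : {fset site d}) eta (w : {ffun L -> spin}) :
  0 <= softcore_weight eta w.
Proof.
by rewrite mulr_ge0 ?expR_ge0// prodr_ge0// => i _; rewrite fine_ge0.
Qed.

Lemma softcore_partition_gt0 L eta : 0 < softcore_partition L eta.
Proof.
have [a a0] : exists a, 0 < fine (alpha [set a]).
  apply: contrapT => /forallNP h; have : alpha setT = 1%E by exact: probability_setT.
  rewrite (_ : setT = \bigcup_(a in setT) [set a]); last first.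
    by apply/seteqP; split => // a _; exists a.
  rewrite measure_fin_bigcup//; last 2 first.
  - exact: finite_finset.
  - by apply/trivIsetP => x y _ _ xy; apply/seteqP; split => // z [-> yx]; move/eqP: xy.
  rewrite fsbig1; first by move/eqP; rewrite eq_sym onee_eq0.
  move=> x _; apply/eqP; rewrite -fine_eq0 ?fin_num_measure//.
  by rewrite eq_le fine_ge0// andbT leNgt; exact/negP/h.
rewrite /softcore_partition (bigD1 [ffun=> a])//= ltr_pwDl//.
  by rewrite mulr_gt0 ?expR_gt0// prodr_gt0// => i _; rewrite ffunE.
by apply: sumr_ge0 => w _; exact: softcore_weight_ge0.
Qed.

Context (L : {fset site d}) (eta : config d).
Local Open Scope ereal_scope.

Let coef_ge0 (w : {ffun L -> spin}) :
  (0 <= softcore_weight eta w / softcore_partition L eta)%R.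
Proof.
by rewrite divr_ge0 ?softcore_weight_ge0// ltW ?softcore_partition_gt0.
Qed.

Let softcore0 : softcore L eta set0 = 0.
Proof. by rewrite /softcore big1// => w _; rewrite measure0 mule0. Qed.

Let softcore_ge0 A : 0 <= softcore L eta A.
Proof. by apply: sume_ge0 => w _; rewrite mule_ge0// lee_fin. Qed.

Let softcore_sigma_additive : semi_sigma_additive (softcore L eta).
Proof.
move=> F mF tF mUF; rewrite /softcore.
under eq_fun do rewrite exchange_big/=.
apply: cvg_nnesum => w _.
  by near=> n; apply: sume_ge0 => i _; rewrite mule_ge0// lee_fin.
under eq_fun do rewrite -ge0_sume_distrr//.
apply: cvgeZl => //; exact: (@measure_semi_sigma_additive _ (config d) R \d_(concat_config w eta)).
Unshelve. all: by end_near. Qed.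

HB.instance Definition _ := isMeasure.Build _ _ R (softcore L eta)
  softcore0 softcore_ge0 softcore_sigma_additive.

Let softcoreT : softcore L eta setT = 1.
Proof.
rewrite /softcore; under eq_bigr do rewrite diracT mule1.
rewrite sumEFin -mulr_suml divff//.
by rewrite gt_eqF// softcore_partition_gt0.
Qed.

HB.instance Definition _ := Measure_isProbability.Build _ _ R
  (softcore L eta) softcoreT.

End softcore.

Definition softcore_family (R : realType) d (beta : R)
    (alpha : probability spin R) : kernel_family R d :=
  fun L eta => softcore beta alpha L eta.

(* Infinite products are not in the library; they are realised below on [0, 1[
   with Lebesgue measure, by splitting an interval successively in proportion
   to the weights. *)
Section digits.
Context {R : realType} (q : nat -> spin -> R).
Hypothesis q0 : forall n a, 0 <= q n a.
Hypothesis q1 : forall n, \sum_a q n a = 1.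

Let cum n (a : spin) : R :=
  if a == spin_minus then 0
  else if a == spin_zero then q n spin_minus
  else q n spin_minus + q n spin_zero.

Let pr := fix pr (s : seq spin) : R :=
  if s is a :: s' then pr s' * q (size s') a else 1.
Let lo := fix lo (s : seq spin) : R :=
  if s is a :: s' then lo s' + pr s' * cum (size s') a else 0.
Let cell s : set R := `[lo s, lo s + pr s[.

Let pr_ge0 s : 0 <= pr s.
Proof. by elim: s => [|a s ih]//=; rewrite mulr_ge0. Qed.

Let next (s : seq spin) (x : R) : spin :=
  if x < lo s + pr s * q (size s) spin_minus then spin_minus
  else if x < lo s + pr s * (q (size s) spin_minus + q (size s) spin_zero)
  then spin_zero else spin_plus.

Let cell_cons a s : cell (a :: s) = cell s `&` [set x | next s x = a].
Proof.
have := q1 (size s); rewrite big_spin/= => q1s.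
have := q0 (size s) spin_minus; have := q0 (size s) spin_zero.
have := q0 (size s) spin_plus; have := pr_ge0 s.
move: q1s; rewrite /cell /next/= /cum.
set p := pr s; set u := q _ _; set v := q _ _; set w := q _ _.
move=> q1s p0 w0 v0 u0.
have pu0 : 0 <= p * u by exact: mulr_ge0.
have pv0 : 0 <= p * v by exact: mulr_ge0.
have pw0 : 0 <= p * w by exact: mulr_ge0.
have pE : p * u + p * v + p * w = p.
  by rewrite -!mulrDr -addrA q1s mulr1.
apply/seteqP; split => x /=; rewrite !in_itv/=.
  case: (spinP a) => -> /=; rewrite ?mulr0 ?addr0 ?mulrDr -/u -/v -/w => /andP[h1 h2].
  - split; first by apply/andP; split; lra.
    by rewrite ifT.
  - split; first by apply/andP; split; lra.
    by rewrite ifF ?ifT //; [lra|apply/negbTE; rewrite -leNgt; lra].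
  - split; first by apply/andP; split; lra.
    by rewrite !ifF //; apply/negbTE; rewrite -leNgt; lra.
move=> [/andP[h1 h2]].
case: ifPn => [xu <-/=|]; first by rewrite mulr0 addr0 h1 xu.
rewrite -leNgt => h3; case: ifPn => [+ <-|+ <-] /=.
  rewrite mulrDr -/v => h4; apply/andP; split; lra.
rewrite -leNgt mulrDr -/w => h4; apply/andP; split; lra.
Qed.

Let measurable_next s a : measurable [set x | next s x = a].
Proof.
rewrite (_ : mkset _ = (next s) @^-1` [set a])// -[X in measurable X]setTI.
suff : measurable_fun setT (next s) by exact.
have lt c : measurable_fun [set: R] (fun x : R => x < c).
  by apply: measurable_fun_ltr.
apply: measurable_fun_ifT => //.
exact: measurable_fun_ifT.
Qed.

Let good := fix good (C : nat -> spin -> bool) m s x : bool :=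
  if m is m'.+1 then C (size s) (next s x) && good C m' (next s x :: s) x
  else true.

Let good_cons C m s : [set x | good C m.+1 s x] =
  \bigcup_(a in [set a | C (size s) a])
    ([set x | next s x = a] `&` [set x | good C m (a :: s) x]).
Proof.
apply/seteqP; split => x /=.
  by move=> /andP[Cx gx]; exists (next s x) => //=; split.
by move=> [a Ca [nx gx]]; rewrite nx gx andbT.
Qed.

Let measurable_good C m s : measurable [set x | good C m s x].
Proof.
elim: m s => [|m ih] s; first by rewrite (_ : mkset _ = setT)//; apply/seteqP; split.
rewrite good_cons; apply: fin_bigcup_measurable; first exact: finite_finset.
by move=> a _; apply: measurableI; [exact: measurable_next|exact: ih].
Qed.

Let mu := @lebesgue_measure R.

Let mu_good C m s : mu (cell s `&` [set x | good C m s x]) =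
  (pr s * \prod_(k < m) \sum_(a | C (size s + k)%N a) q (size s + k) a)%:E.
Proof.
elim: m s => [|m ih] s.
  rewrite big_ord0 mulr1 (_ : [set _ | _] = setT); last by apply/seteqP; split.
  rewrite setIT /mu /cell lebesgue_measure_itv/= lte_fin ltrDl.
  case: ifPn => [_|]; first by rewrite -EFinD addrAC subrr add0r.
  by rewrite -leNgt => h; congr EFin; apply/eqP; rewrite eq_le pr_ge0 h.
rewrite good_cons setI_bigcupr.
rewrite (_ : \bigcup_(a in _) _ = \bigcup_(a in [set a | C (size s) a])
  (cell (a :: s) `&` [set x | good C m (a :: s) x])); last first.
  by apply: eq_bigcupr => a _; rewrite cell_cons setIA.
rewrite /mu measure_fin_bigcup; last 3 first.
- exact: finite_finset.
- apply/trivIsetP => a b _ _ ab; rewrite !cell_cons.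
  apply/seteqP; split => x //= [[[_ xa] _] [[_ xb] _]].
  by move: ab; rewrite -xa -xb eqxx.
- move=> a _; apply: measurableI; last exact: measurable_good.
  by rewrite /cell; exact: measurable_itv.
rewrite (eq_fsbigr (fun a => (pr (a :: s) * \prod_(k < m)
  \sum_(b | C (size (a :: s) + k)%N b) q (size (a :: s) + k) b)%:E)); last first.
  by move=> a _; exact: ih.
rewrite -(@bigfs _ _ _ _ (index_enum spin) (C (size s)))/=; last 2 first.
- exact: index_enum_uniq.
- by move=> a _; rewrite mem_index_enum.
rewrite sumEFin; congr EFin; rewrite big_ord_recl addn0 mulrA big_distrr/=.
rewrite big_distrl/=; apply: eq_bigr => a _.
by congr (_ * _); apply: eq_bigr => k _; rewrite addSnnS.
Qed.

Let step x s := next s x :: s.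
Let digit n (x : R) : spin := head point (iter n.+1 (step x) [::]).

Let size_step n x s : size (iter n (step x) s) = (size s + n)%N.
Proof. by elim: n => [|n ih]; rewrite ?addn0//= ih addnS. Qed.

Let goodP (C : nat -> spin -> bool) m s x : reflect
  (forall k, (k < m)%N -> C (size s + k)%N (head point (iter k.+1 (step x) s)))
  (good C m s x).
Proof.
elim: m s => [|m ih] s; first by constructor.
apply: (iffP andP) => [[Cs /ih g] [|k] km|h].
- by rewrite addn0.
- by have := g k km; rewrite /= -iterSr/= addSnnS.
- split; first by have := h 0%N isT; rewrite addn0.
  by apply/ih => k km; have := h k.+1 km; rewrite /= addSnnS -iterSr.
Qed.

Let mu_digits (C : nat -> spin -> bool) m :
  mu (`[0%R, 1%R[ `&` [set x | forall k, (k < m)%N -> C k (digit k x)]) =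
  (\prod_(k < m) \sum_(a | C k a) q k a)%:E.
Proof.
have := mu_good C m [::]; rewrite /cell/= add0r mul1r => <-.
by congr (mu (_ `&` _)); apply/seteqP; split => x /= /goodP.
Qed.

Let measurable_digits (C : nat -> spin -> bool) m :
  measurable [set x | forall k, (k < m)%N -> C k (digit k x)].
Proof.
have := measurable_good C m [::]; congr measurable.
by apply/seteqP; split => x /= /goodP.
Qed.

Lemma product_digits : exists D : nat -> R -> spin,
  (forall (C : nat -> spin -> bool) m, measurable [set x | forall k, (k < m)%N -> C k (D k x)]) /\
  (forall (C : nat -> spin -> bool) m, @lebesgue_measure R
     (`[0%R, 1%R[ `&` [set x | forall k, (k < m)%N -> C k (D k x)]) =
     (\prod_(k < m) \sum_(a | C k a) q k a)%:E).
Proof. by exists digit. Qed.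

End digits.

(* P is the product over the sites i of the probability measures on E with
   weights q i. *)
Definition is_product (R : realType) d (q : site d -> spin -> R)
    (P : probability (config d) R) : Prop :=
  forall (L : {fset site d}) (z : site d -> spin),
    P [set w | forall i, i \in L -> w i = z i] = (\prod_(i <- L) q i (z i))%:E.

Section existence.
Context (R : realType) (d : nat) (q : site d -> spin -> R).
Hypothesis q0 : forall i a, 0 <= q i a.
Hypothesis q1 : forall i, \sum_a q i a = 1.

Let qn n a : R :=
  if choice.unpickle n is Some i then q i a else (a == spin_zero)%:R.

Let qn0 n a : 0 <= qn n a.
Proof. by rewrite /qn; case: choice.unpickle => // ; rewrite ler0n. Qed.

Let qn1 n : \sum_a qn n a = 1.
Proof.
rewrite /qn; case: choice.unpickle => //.
by rewrite (bigD1 spin_zero)//= big1 ?addr0// => a /negbTE ->.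
Qed.

Let D := projT1 (cid (product_digits qn0 qn1)).
Let mD := (projT2 (cid (product_digits qn0 qn1))).1.
Let muD := (projT2 (cid (product_digits qn0 qn1))).2.

Let Phi (x : R) : config d := fun i => D (choice.pickle i) x.

Let mPhi : measurable_fun setT Phi.
Proof.
apply: (@measurability _ _ _ (config d) setT Phi (cylinders [set: site d])) => //.
move=> _ [_ [i _ [B ->]] <-]; rewrite setTI.
have := mD (fun k a => (k == choice.pickle i) ==> `[<B a>]) (choice.pickle i).+1.
congr measurable; apply/seteqP; split => x /=.
  by move=> /(_ (choice.pickle i) (leqnn _)); rewrite eqxx/= => /asboolP.
by move=> Bx k _; apply/implyP => /eqP ->; exact/asboolP.
Qed.

Let m01 : measurable (`[0%R, 1%R[ : set R) := measurable_itv _.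
Let mPhiR : measurable_fun [set: measurableTypeR R] Phi := mPhi.
Let P0 : {measure set (config d) -> \bar R} :=
  measure_function_pushforward__canonical__measure_function_Measure
    (mrestr (@lebesgue_measure R) m01) mPhiR.

Let P0T : P0 setT = 1%E.
Proof.
rewrite (_ : P0 setT = lebesgue_measure (setT `&` `[0%R, 1%R[%classic : set R))//.
by rewrite setTI lebesgue_measure_itv/= lte_fin ltr01 -EFinD subr0.
Qed.

Let P0_product (L : {fset site d}) (z : site d -> spin) :
  P0 [set w | forall i, i \in L -> w i = z i] = (\prod_(i <- L) q i (z i))%:E.
Proof.
rewrite /P0 /= /pushforward /mrestr setIC.
pose C k a := all (fun i => (choice.pickle i == k) ==> (a == z i)) L.
pose m := (\max_(i <- L) choice.pickle i).+1.
have Lm i : i \in L -> (choice.pickle i < m)%N.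
  by move=> iL; rewrite ltnS; exact: leq_bigmax_seq.
rewrite (_ : Phi @^-1` _ =
    [set x | forall k, (k < m)%N -> C k (D k x)]); last first.
  apply/seteqP; split => x /=.
    by move=> h k km; apply/allP => i iL; apply/implyP => /eqP <-; apply/eqP/h.
  move=> h i iL; have /allP/(_ i iL) := h _ (Lm i iL).
  by rewrite eqxx/= => /eqP.
rewrite muD; congr EFin.
transitivity (\prod_(k < m) \prod_(i <- L | choice.pickle i == k) q i (z i)).
  apply: eq_bigr => k _.
  have [[i iL ik]|noi] := pselect (exists2 i, i \in L & choice.pickle i = k).
    have uniqi j : (choice.pickle j == k) = (j == i).
      apply/eqP/eqP => [|-> //]; rewrite -ik.
      exact: (pcan_inj (@choice.pickleK _)).
    under [RHS]eq_bigl do rewrite uniqi.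
    rewrite -big_filter (_ : seq.filter _ _ = [:: i]); last first.
      by rewrite filter_pred1_uniq.
    rewrite big_seq1 (eq_bigl (pred1 (z i))); last first.
      move=> a; apply/allP/eqP => [/(_ i iL)|-> j jL]; first by rewrite ik eqxx/= => /eqP.
      by apply/implyP; rewrite uniqi => /eqP ->.
    by rewrite big_pred1_eq /qn -ik choice.pickleK.
  rewrite [LHS](eq_bigl predT) ?qn1; last first.
    move=> a; apply/allP => i iL; apply/implyP => /eqP ik.
    by exfalso; apply: noi; exists i.
  rewrite big_seq_cond big1// => i /andP[iL /eqP ik].
  by exfalso; apply: noi; exists i.
rewrite (exchange_big_dep predT)//= big_seq [RHS]big_seq.
apply: eq_bigr => i iL.
by rewrite (big_pred1 (Ordinal (Lm i iL)))//= => k; rewrite eq_sym -val_eqE.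
Qed.

Lemma product_exists : exists P : probability (config d) R, is_product q P.
Proof.
exists (mnormalize P0 \d_point) => L z.
have E A : mnormalize P0 \d_point A = P0 A.
  by rewrite /mnormalize P0T onee_eq0/= invr1 mule1.
by rewrite -P0_product; exact: E.
Qed.

End existence.

Section pinned_sets.
Context (d : nat).

Definition pinned (L : {fset site d}) (z : site d -> spin) : set (config d) :=
  [set w | forall i, i \in L -> w i = z i].

Definition pinned_sets : set (set (config d)) :=
  [set A | A = set0 \/ exists L z, A = pinned L z].

Lemma pinned_setsI : setI_closed pinned_sets.
Proof.
move=> A B [->|[L [z ->]]]; first by left; rewrite set0I.
move=> [->|[M [y ->]]]; first by left; rewrite setI0.
have [zy|/existsNP[i /not_implyP[iL /not_implyP[iM zyi]]]] :=
  pselect (forall i, i \in L -> i \in M -> z i = y i).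
  right; exists (L `|` M)%fset, (fun i => if i \in L then z i else y i).
  apply/seteqP; split => w /=.
    by move=> [wL wM] i; rewrite inE; case: ifPn => [/wL|_ /= /wM].
  move=> h; split => i iLM.
    by have := h i; rewrite inE iLM => ->.
  have := h i; rewrite inE iLM orbT => ->//.
  by case: ifPn => // iL; exact: zy.
left; apply/seteqP; split => // w [wL wM]; apply: zyi.
by rewrite -(wL _ iL) -(wM _ iM).
Qed.

Lemma coordinate_measurable (i : site d) (B : set spin) :
  measurable ([set w | B (w i)] : set (config d)).
Proof. by apply: sub_sigma_algebra; exists i => //; exists B. Qed.

Lemma measurable_pinned L z : measurable (pinned L z).
Proof.
rewrite (_ : pinned L z = \bigcap_(i in [set` L]) [set w | w i = z i]).
  by apply: fin_bigcap_measurable => // i _; exact: (coordinate_measurable i [set z i]).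
by apply/seteqP; split.
Qed.

Lemma measurable_pinned_sets : @measurable _ (config d) = <<s pinned_sets >>.
Proof.
apply/seteqP; split; last first.
  apply: smallest_sub; first exact: sigma_algebra_measurable.
  move=> A [->|[L [z ->]]]; first exact: measurable0.
  exact: measurable_pinned.
apply: smallest_sub; first exact: smallest_sigma_algebra.
move=> _ [i _ [B ->]].
have -> : [set w : site d -> spin | B (w i)] =
    \bigcup_(a in B) pinned [fset i]%fset (fun=> a).
  apply/seteqP; split => w /=.
    by move=> Bw; exists (w i) => // j; rewrite inE => /eqP ->.
  by move=> [a Ba /(_ i)]; rewrite inE eqxx => ->.
pose S : measurableType _ := g_sigma_algebraType pinned_sets.
apply: (@fin_bigcup_measurable _ S _ _ (fun a => pinned [fset i]%fset (fun=> a))); first exact: finite_finset.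
move=> a _; apply: sub_sigma_algebra; right.
by exists [fset i]%fset, (fun=> a).
Qed.

Lemma is_product_unique (R : realType) (q : site d -> spin -> R)
    (P Q : probability (config d) R) :
  is_product q P -> is_product q Q ->
  forall A, measurable A -> P A = Q A.
Proof.
move=> Pq Qq A; rewrite measurable_pinned_sets.
apply: (@dynkin_induction _ (config d) pinned_sets (fun A => P A = Q A)
  measurable_pinned_sets pinned_setsI).
- by rewrite !probability_setT.
- by move=> _ [->|[L [z ->]]]; rewrite ?measure0// Pq Qq.
- by move=> S mS PQ; rewrite !probability_setC// PQ.
- move=> F mF tF PQ; rewrite !measure_bigcup//.
  by apply: eq_eseriesr => n _; exact: PQ.
Qed.

Lemma measurable_product_kernel (R : realType) (q : config d -> site d -> spin -> R)
    (K : config d -> probability (config d) R) :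
  (forall w, is_product (q w) (K w)) ->
  (forall i a, measurable_fun [set: config d] (fun w => q w i a)) ->
  forall A, measurable A -> measurable_fun [set: config d] (fun w => K w A).
Proof.
move=> Kq mq A; rewrite measurable_pinned_sets.
apply: (@dynkin_induction _ (config d) pinned_sets
  (fun A => measurable_fun [set: config d] (fun w => K w A))
  measurable_pinned_sets pinned_setsI).
- by under eq_fun do rewrite probability_setT; exact: measurable_cst.
- move=> _ [->|[L [z ->]]].
    by under eq_fun do rewrite measure0; exact: measurable_cst.
  rewrite (_ : (fun _ => _) = (fun w => (\prod_(i <- L) q w i (z i))%:E)).
    by apply/measurable_EFinP; apply: measurable_prod => i _.
  by apply/funext => w; rewrite Kq.
- move=> S mS mKS; rewrite (_ : (fun _ => _) = (fun w => 1%E - K w S)%E).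
    exact: emeasurable_funB.
  by apply/funext => w; rewrite probability_setC.
- move=> F mF tF mKF.
  rewrite (_ : (fun _ => _) = (fun w =>
    \sum_(n <oo | n \in [set: nat]) K w (F n))%E).
    by apply: ge0_emeasurable_sum => // n _ w _.
  by apply/funext => w; rewrite measure_bigcup.
Qed.
End pinned_sets.

(* The choice is unambiguous on measurable sets (is_product_unique), and
   legitimate for probability weights (product_measureP). *)
Definition product_measure (R : realType) d (q : site d -> spin -> R) :
    probability (config d) R :=
  get [set P | is_product q P].

Lemma product_measureP (R : realType) d (q : site d -> spin -> R) :
  (forall i a, 0 <= q i a) -> (forall i, \sum_a q i a = 1) ->
  is_product q (product_measure q).
Proof. by move=> q0 q1; apply: getPex; exact: product_exists. Qed.

Section time_evolution.
Context {R : realType}.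

(* p_t(a, b) *)
Definition transition (t : R) (a b : spin) : R :=
  2^-1 * (1 + expR (- 2 * t)) * ((a == b) && (spin_val a != 0))%:R +
  2^-1 * (1 - expR (- 2 * t)) * (spin_val a * spin_val b == -1)%:R +
  ((a == b) && (spin_val a == 0))%:R.

Lemma transition_ge0 (t : R) a b : 0 <= t -> 0 <= transition t a b.
Proof.
move=> t0; have e1 : expR (- 2 * t) <= 1.
  by rewrite -[leRHS]expR0 ler_expR; lra.
have e0 := expR_ge0 (- 2 * t).
by rewrite /transition !addr_ge0// !mulr_ge0// ?subr_ge0 ?addr_ge0.
Qed.

Lemma transition_sum1 (t : R) a : \sum_b transition t a b = 1.
Proof.
rewrite big_spin /transition; case: (spinP a) => ->;
  by rewrite -!val_eqE/= /spin_val/= ?eqxx/=; lra.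
Qed.

Context (d : nat).

Definition transition_kernel (t : {posnum R}) (w : config d) :
    {measure set (config d) -> \bar R} :=
  product_measure (fun i => transition t%:num (w i)).

Let measurable_transition_kernel t A : measurable A ->
  measurable_fun [set: config d] (fun w => transition_kernel t w A).
Proof.
apply: (measurable_product_kernel (q := fun w i => transition t%:num (w i))).
  move=> w; apply: product_measureP => i; last exact: transition_sum1.
  by move=> a; rewrite transition_ge0.
move=> i a _ B _; rewrite setTI.
exact: (coordinate_measurable i [set b | B (transition t%:num b a)]).
Qed.

HB.instance Definition _ t := @isKernel.Build _ _ _ _ R (transition_kernel t)
  (@measurable_transition_kernel t).

Let transition_kernelT t w : transition_kernel t w setT = 1%E.
Proof. exact: probability_setT. Qed.

HB.instance Definition _ t := @Kernel_isProbability.Build _ _ _ _ R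
  (transition_kernel t) (transition_kernelT t).

(* mu_t = mu p_t, a probability measure by the instances below *)
Definition evolve (t : {posnum R}) (mu : probability (config d) R)
    (A : set (config d)) : \bar R :=
  (\int[mu]_w transition_kernel t w A)%E.

Context (t : {posnum R}) (mu : probability (config d) R).
Local Open Scope ereal_scope.

Let evolve0 : evolve t mu set0 = 0.
Proof. by apply: integral0_eq => w _; rewrite measure0. Qed.

Let evolve_ge0 A : 0 <= evolve t mu A.
Proof. by apply: integral_ge0 => w _; exact: measure_ge0. Qed.

Let evolve_sigma_additive : semi_sigma_additive (evolve t mu).
Proof.
move=> F mF tF mUF; rewrite [X in _ --> X](_ : _ =
  \int[mu]_w (\sum_(n <oo) transition_kernel t w (F n))); last first.
  apply: eq_integral => w _.
  by apply/esym/cvg_lim => //; exact/measure_semi_sigma_additive.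
apply/cvg_closeP; split.
  by apply: is_cvg_nneseries => n _ _; exact: integral_ge0.
by rewrite closeE// integral_nneseries// => n; exact: measurable_transition_kernel.
Qed.

HB.instance Definition _ := isMeasure.Build _ _ R (evolve t mu)
  evolve0 evolve_ge0 evolve_sigma_additive.

Let evolveT : evolve t mu setT = 1.
Proof.
rewrite /evolve; under eq_integral do rewrite transition_kernelT.
by rewrite integral_cst// mul1e; exact: probability_setT.
Qed.

HB.instance Definition _ := Measure_isProbability.Build _ _ R (evolve t mu)
  evolveT.

End time_evolution.

(* Main.v *)
Require Import Defs.
From HB Require Import structures.
From mathcomp Require Import all_boot all_order all_algebra finmap.
From mathcomp Require Import zify ring lra.
From mathcomp Require Import all_classical all_reals all_analysis.
From mathcomp Require Import measurable_realfun.

Set Implicit Arguments.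
Unset Strict Implicit.
Unset Printing Implicit Defensive.

Import Order.TTheory GRing.Theory Num.Theory.
Import numFieldNormedType.Exports.

Local Open Scope classical_set_scope.
Local Open Scope ring_scope.

(** Why short-time evolution preserves the Gibbs property.

    Let c(a) be the law at time t of one spin started from alpha, and let
    q(a, .) be the law of its initial value given its value a at time t, so
    that alpha(b) p_t(b, a) = c(a) q(a, b).  If mu is a soft-core Gibbs measure
    and V is finite, the DLR equation in V gives the weight of a cylinder,

      mu_t(eta on V) = prod_(i in V) c(eta_i) * E_mu[Z_V(w, eta) / N_V(w)],

    where w is the configuration outside V, N_V(w) the soft-core normalisation
    and Z_V(w, eta) the partition function of the initial spins with
    single-site laws q(eta_i, .) ([softcore_evolved], [evolve_pinned]).  Hence
    the conditional probabilities of mu_t are governed by the ratios of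
    Z_V(w, eta) at configurations eta which differ at finitely many sites, and
    it is enough that these ratios lose their dependence on the boundary
    condition w when V exhausts the lattice, uniformly in w and eta.

    For small t every law q(a, .) is almost a point mass:
    q(a, b) q(a, b') <= eps for b <> b' ([posterior_small]).  This pins the
    initial spins at a site given the spin at time t, uniformly in eta, and
    forces decay of correlations.  The decay comes from a recursion on the
    vector of ratios of partition functions conditioned on the spin at a site
    i: changing that spin along the bonds of i one at a time writes a ratio as a
    product of quotients (sum_b x_b r_b) / (sum_b y_b r_b), one for each
    neighbour j, where r is the same vector of ratios at j in the region
    without i.  In the difference of two such quotients the diagonal terms
    cancel and the remaining ones carry a factor x_b y_b' <= eps
    ([ratio_contract]), so a small eps gives a contraction by 1/2 at each step
    away from i ([ratio_decay]).

    Normalised finite-volume weights c * Z_V therefore converge uniformly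
    ([finite_cond_lim]).  They satisfy the consistency relations of a
    specification exactly ([cond_avg_avg]), and so does their limit; uniform
    convergence of functions of finitely many spins makes the limit quasilocal
    ([limit_is_specification], [limit_quasilocal]).  The same identity in a
    large box, integrated against mu, shows that mu_t is admitted by the limit
    ([evolve_dlr]).

    All weights are divided by c before ratios are formed, and q(a, .) is the
    point mass at a when c(a) = 0.  This makes every Z_V positive, so that the
    argument covers degenerate alpha too. *)

(** * Sums over the spins in a finite set of sites *)

Section finite_sums.
Context {R : realType} (d : nat).
Implicit Types (L D V : {fset site d}) (eta : config d) (i j : site d).

Definition set_spin eta i (a : spin) : config d :=
  fun j => if j == i then a else eta j.

Lemma concat_in L (w : {ffun L -> spin}) eta (x : L) :
  concat_config w eta (val x) = w x.
Proof. by rewrite /concat_config valK. Qed.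

Lemma concat_inE L (w : {ffun L -> spin}) eta i (iL : i \in L) :
  concat_config w eta i = w [` iL]%fset.
Proof. exact: (concat_in w eta [` iL]%fset). Qed.

Lemma concat_out L (w : {ffun L -> spin}) eta i :
  i \notin L -> concat_config w eta i = eta i.
Proof. by move=> iL; rewrite /concat_config insubN. Qed.

Lemma concat_eq_in L (w : {ffun L -> spin}) eta eta' i :
  i \in L -> concat_config w eta i = concat_config w eta' i.
Proof. by move=> iL; rewrite !concat_inE. Qed.

Lemma concat_eq_off L (w : {ffun L -> spin}) eta eta' :
  (forall i, i \notin L -> eta i = eta' i) ->
  concat_config w eta = concat_config w eta'.
Proof.
move=> e; apply/funext => i; case: (boolP (i \in L)) => iL.
  exact: concat_eq_in.
by rewrite !concat_out// e.
Qed.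

Lemma concat_concat L (w v : {ffun L -> spin}) eta :
  concat_config v (concat_config w eta) = concat_config v eta.
Proof. by apply: concat_eq_off => i iL; rewrite concat_out. Qed.

Definition restr L eta : {ffun L -> spin} := [ffun x => eta (val x)].

Lemma concat_restr L eta eta' i :
  concat_config (restr L eta) eta' i = if i \in L then eta i else eta' i.
Proof.
case: ifPn => iL; last by rewrite concat_out.
by rewrite concat_inE ffunE.
Qed.

Definition sum_on L (F : config d -> R) eta : R :=
  \sum_(w : {ffun L -> spin}) F (concat_config w eta).

Lemma sum_on_fset0 F eta : sum_on fset0 F eta = F eta.
Proof.
rewrite /sum_on (bigD1 [ffun=> spin_zero])//= big1 ?addr0.
  by congr F; apply/funext => i; rewrite concat_out// inE.
move=> w /negP[]; apply/eqP/ffunP => -[x xP]; by have := xP; rewrite in_fset0.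
Qed.

Lemma sum_on_fsetD1 L i F eta : i \in L ->
  sum_on L F eta = \sum_a sum_on (L `\ i)%fset F (set_spin eta i a).
Proof.
move=> iL; rewrite /sum_on.
rewrite (partition_big (fun w : {ffun L -> spin} => w [` iL]%fset) predT)//=.
apply: eq_bigr => a _.
pose h (w : {ffun (L `\ i)%fset -> spin}) := restr L (concat_config w (fun=> a)).
pose h' (w : {ffun L -> spin}) := restr (L `\ i)%fset (concat_config w (fun=> a)).
have hh' (w : {ffun L -> spin}) : w [` iL]%fset = a -> h (h' w) = w.
  move=> wa; apply/ffunP => x; rewrite /h ffunE concat_restr !inE.
  rewrite concat_in (valP x) andbT; case: eqVneq => //= xi.
  by rewrite -wa; congr (w _); apply: val_inj.
have h'h w : h' (h w) = w.
  apply/ffunP => x; have := valP x; rewrite !inE => /andP[xi xL].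
  by rewrite /h' ffunE concat_restr xL concat_in.
rewrite (reindex_onto h h')/=; last by move=> w /eqP wa; exact: hh'.
apply: eq_big => w.
  rewrite h'h eqxx andbT /h ffunE/= concat_out ?eqxx//.
  by rewrite !inE eqxx.
move=> _; congr F; apply/funext => j; rewrite /h concat_restr.
case: ifPn => jL; last by rewrite concat_out ?inE ?(negbTE jL) ?andbF// /set_spin; case: eqVneq jL => // ->; rewrite iL.
case: (eqVneq j i) => [->|ji].
  by rewrite !concat_out ?inE ?eqxx// /set_spin eqxx.
by apply: concat_eq_in; rewrite !inE ji.
Qed.

(** Recursions below remove one site at a time from a region, and which site
    is dictated by the geometry; hence an induction in which any site may be
    chosen. *)
Lemma fset_ind_size (P : {fset site d} -> Prop) :
  P fset0 -> (forall L i, i \in L -> P (L `\ i)%fset -> P L) -> forall L, P L.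
Proof.
move=> P0 Pi L; have [n] := ubnP #|` L|; elim: n L => // n ih L Ln.
have [->//|[i iL]] := fset_0Vmem L.
apply: (Pi _ _ iL); apply: ih.
by move: Ln; rewrite (cardfsD1 i L) iL.
Qed.

Lemma sum_on_sub L D F eta : (D `<=` L)%fset ->
  sum_on L F eta = sum_on (L `\` D)%fset (sum_on D F) eta.
Proof.
move: L eta => L eta.
move: {2}(L `\` D)%fset (erefl (L `\` D)%fset) => M.
elim/fset_ind_size : M L eta => [|M i iM ih] L eta ME DL.
  rewrite ME sum_on_fset0; congr (sum_on _ _ _); apply/eqP.
  by rewrite eqEfsubset DL andbT -fsetD_eq0 ME.
have [iL iD] : i \in L /\ i \notin D.
  by move: iM; rewrite -ME inE => /andP[].
rewrite (sum_on_fsetD1 _ _ iL) (@sum_on_fsetD1 (L `\` D)%fset i) ?ME//.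
apply: eq_bigr => a _.
have e : ((L `\ i) `\` D = M `\ i)%fset.
  by rewrite -ME; apply/fsetP => j; rewrite !inE andbCA.
rewrite ih//; last first.
  apply/fsubsetP => j jD; rewrite !inE (fsubsetP DL)// andbT.
  by apply: contra iD => /eqP <-.
by rewrite e.
Qed.

Lemma sum_on_eq_off L F eta eta' :
  (forall i, i \notin L -> eta i = eta' i) -> sum_on L F eta = sum_on L F eta'.
Proof. by move=> e; apply: eq_bigr => w _; rewrite (concat_eq_off w e). Qed.

Lemma eq_sum_on L F G eta :
  (forall w : {ffun L -> spin}, F (concat_config w eta) = G (concat_config w eta)) ->
  sum_on L F eta = sum_on L G eta.
Proof. by move=> e; apply: eq_bigr => w _. Qed.

End finite_sums.

(** * Partition functions with site-dependent fields *)

Lemma neighbors_sym d (i j : site d) : neighbors i j = neighbors j i.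
Proof. by rewrite /neighbors; under eq_bigr do rewrite distrC. Qed.

Lemma neighbors_irr d (i : site d) : neighbors i i = false.
Proof. by rewrite /neighbors big1// => k _; rewrite subrr. Qed.

Section partition_function.
Context {R : realType} (d : nat) (u : spin -> spin -> R).
Implicit Types (V : {fset site d}) (h : site d -> spin -> R) (i j : site d).

(** Partition functions multiply over ordered pairs of sites, so that an
    unordered bond contributes u a b * u b a.  This keeps sums and products over
    regions symmetric. *)
Definition bond_weight i j a b : R := if neighbors i j then u a b else 1.

Definition gibbs_weight V h (s : config d) : R :=
  \prod_(j <- V) h j (s j) *
  \prod_(j <- V) \prod_(k <- V) bond_weight j k (s j) (s k).

Definition partition_fun V h : R := sum_on V (gibbs_weight V h) (fun=> spin_zero).

(** Once the spin at i is fixed to c, its bonds act on the remaining spins as a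
    field.  Regions thus shrink without boundary conditions having to be
    tracked. *)
Definition field_add h i c : site d -> spin -> R :=
  fun j b => h j b * (bond_weight i j c b * bond_weight j i b c).

Lemma partition_fun0 h : partition_fun fset0 h = 1.
Proof. by rewrite /partition_fun sum_on_fset0 /gibbs_weight !big_seq_fset0 mulr1. Qed.

Lemma eq_partition_fun V h h' : (forall j, j \in V -> h j = h' j) -> partition_fun V h = partition_fun V h'.
Proof.
move=> e; apply: eq_sum_on => w; congr (_ * _).
by rewrite !big_seq; apply: eq_bigr => j jV; rewrite e.
Qed.

Lemma partition_fun_fsetD1 V h i : i \in V ->
  partition_fun V h = \sum_c h i c * partition_fun (V `\ i)%fset (field_add h i c).
Proof.
move=> iV; rewrite /partition_fun (sum_on_fsetD1 _ _ iV); apply: eq_bigr => c _.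
rewrite /sum_on big_distrr/=; apply: eq_bigr => w _.
set s := concat_config w _; set s' := concat_config w _.
have si : s i = c by rewrite /s concat_out ?inE ?eqxx// /set_spin eqxx.
have ss' j : j \in (V `\ i)%fset -> s j = s' j by move=> jV; exact: concat_eq_in.
rewrite /gibbs_weight (big_fsetD1 i iV)/= si -mulrA; congr (_ * _).
rewrite [X in _ * X = _](big_fsetD1 i iV)/= (big_fsetD1 i iV)/=.
rewrite {1}/bond_weight neighbors_irr mul1r si.
under [X in _ * (_ * X)]eq_bigr do rewrite (big_fsetD1 i iV)/= si.
rewrite big_split/= !mulrA; congr (_ * _); last first.
  rewrite big_seq [RHS]big_seq; apply: eq_bigr => j /ss' ->.
  by rewrite big_seq [RHS]big_seq; apply: eq_bigr => k /ss' ->.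
rewrite -!big_split/= big_seq [RHS]big_seq; apply: eq_bigr => j /ss' ->.
by rewrite /field_add mulrA.
Qed.

(** Each site has some spin of positive weight; expanding the sum at one site
    and inducting on the region avoids choosing these spins simultaneously. *)
Lemma partition_fun_gt0 V h : (forall a b, 0 < u a b) ->
  (forall j b, j \in V -> 0 <= h j b) ->
  (forall j, j \in V -> 0 < \sum_b h j b) -> 0 < partition_fun V h.
Proof.
move=> u0; have w0 i j a b : 0 < bond_weight i j a b.
  by rewrite /bond_weight; case: ifP.
elim/fset_ind_size : V h => [|V i iV ih] h h0 hs; first by rewrite partition_fun0.
rewrite (partition_fun_fsetD1 _ iV).
have X0 c : 0 < partition_fun (V `\ i)%fset (field_add h i c).
  apply: ih => [j b|j]; rewrite !inE => /andP[_ jV].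
    by rewrite /field_add !mulr_ge0 ?h0// ltW.
  rewrite lt_neqAle eq_sym sumr_ge0 ?andbT; last first.
    by move=> b _; rewrite /field_add !mulr_ge0 ?h0// ltW.
  rewrite psumr_neq0; last first.
    by move=> b _; rewrite /field_add !mulr_ge0 ?h0// ltW.
  have := hs j jV; rewrite lt0r psumr_neq0 => [/andP[/hasP[b bb hb] _]|b _]; last exact: h0.
  by apply/hasP; exists b => //; rewrite /= /field_add mulr_gt0 ?mulr_gt0.
have := hs i iV; rewrite lt0r psumr_neq0 => [/andP[/hasP[b bb hb] _]|b _]; last exact: h0.
rewrite lt0r sumr_ge0 ?andbT; last by move=> c _; rewrite mulr_ge0 ?h0// ltW.
rewrite psumr_neq0; last by move=> c _; rewrite mulr_ge0 ?h0// ltW.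
by apply/hasP; exists b => //=; rewrite mulr_gt0.
Qed.

End partition_function.

(** * The contraction estimate *)

Section ratio.
Context {R : realType}.

(** Cross-multiplying turns the difference of the two quotients into
    sum_(b, b') x_b y_b' (r_b r'_b' - r'_b r_b'), whose terms with b = b' vanish.
    Six terms remain, each at most th * 2 A e. *)
Lemma ratio_contract (x y r r' : spin -> R) (th A e m : R) :
  (forall b, 0 <= x b) -> (forall b, 0 <= y b) ->
  (forall b b', b != b' -> x b * y b' <= th) ->
  (forall b, 0 < r b <= A) -> (forall b, 0 < r' b <= A) ->
  (forall b, `|r b - r' b| <= e) -> 0 < m ->
  m <= \sum_b y b * r b -> m <= \sum_b y b * r' b ->
  `|(\sum_b x b * r b) / (\sum_b y b * r b) -
    (\sum_b x b * r' b) / (\sum_b y b * r' b)| <= 12 * th * A * e / m ^+ 2.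
Proof.
move=> x0 y0 xy rA r'A re m0 mr mr'.
set N := \sum_b x b * r b; set M := \sum_b y b * r b.
set N' := \sum_b x b * r' b; set M' := \sum_b y b * r' b.
have M0 : 0 < M by exact: lt_le_trans mr.
have M'0 : 0 < M' by exact: lt_le_trans mr'.
have -> : N / M - N' / M' = (N * M' - N' * M) / (M * M').
  by field; rewrite !gt_eqF.
rewrite normrM normfV [X in _ / X]gtr0_norm ?mulr_gt0//.
have e0 : 0 <= e by exact: le_trans (re spin_zero).
have A0 : 0 <= A by have /andP[a0 aA] := rA spin_zero; exact: le_trans (ltW a0) aA.
have th0 : 0 <= th.
  have /xy : spin_zero != spin_plus by [].
  by apply: le_trans; rewrite mulr_ge0.
have cr b b' : `|r b * r' b' - r' b * r b'| <= 2 * A * e.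
  have -> : r b * r' b' - r' b * r b' = r b * (r' b' - r b') + (r b - r' b) * r b' by ring.
  apply: le_trans (ler_normD _ _) _; rewrite !normrM (distrC (r' b')).
  have /andP[b0 bA] := rA b; have /andP[b'0 b'A] := rA b'.
  rewrite (gtr0_norm b0) (gtr0_norm b'0).
  have -> : 2 * A * e = A * e + e * A by ring.
  by rewrite lerD// ler_pM// ltW.
have NM : `|N * M' - N' * M| <= 12 * th * A * e.
  have -> : N * M' - N' * M = \sum_b \sum_b' x b * y b' * (r b * r' b' - r' b * r b').
    rewrite /N /M /N' /M' !big_distrlr/= -sumrB; apply: eq_bigr => b _.
    by rewrite -sumrB; apply: eq_bigr => b' _; ring.
  have t b b' : b != b' -> `|x b * y b' * (r b * r' b' - r' b * r b')| <= th * (2 * A * e).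
    by move=> bb'; rewrite normrM ger0_norm ?mulr_ge0// ler_pM ?mulr_ge0// xy.
  have z b : x b * y b * (r b * r' b - r' b * r b) = 0 by ring.
  rewrite !big_spin/= !z.
  rewrite !(addr0, add0r).
  have -> : 12 * th * A * e = (th * (2 * A * e) + th * (2 * A * e)) +
     ((th * (2 * A * e) + th * (2 * A * e)) + (th * (2 * A * e) + th * (2 * A * e))) by ring.
  do ![apply: le_trans (ler_normD _ _) _; rewrite ?lerD//]; exact: t.
rewrite ler_pM ?invr_ge0 ?mulr_ge0 ?(ltW M0) ?(ltW M'0)//.
by rewrite lef_pV2 ?posrE ?mulr_gt0 ?exprn_gt0// expr2 ler_pM// ltW.
Qed.

End ratio.

(** * Distances and boxes in the lattice *)

Section lattice_geometry.
Context (d : nat).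
Implicit Types i j : site d.

Definition nbrs i : seq (site d) :=
  undup [seq j <- [seq i + (if u.2 then 1 else -1) *: delta_mx ord0 u.1
                  | u <- enum {: 'I_d * bool}] | neighbors i j].

Lemma mem_nbrs i j : (j \in nbrs i) = neighbors i j.
Proof.
rewrite mem_undup mem_filter; case: (boolP (neighbors i j)) => //= ij.
have [k [b ->]] := neighborsP ij.
by apply/mapP; exists (k, b) => //; rewrite mem_enum.
Qed.

Lemma nbrs_uniq i : uniq (nbrs i). Proof. exact: undup_uniq. Qed.

Lemma size_nbrs i : (size (nbrs i) <= 2 * d)%N.
Proof.
apply: leq_trans (size_undup _) _; rewrite size_filter.
apply: leq_trans (count_size _ _) _.
by rewrite size_map -cardE card_prod card_ord card_bool mulnC.
Qed.

(** The sup norm: a path of n bonds started at i stays in the ball of radius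
    site_norm i + n, and the balls are cubes. *)
Definition site_norm i : nat := \max_(k < d) `|i ord0 k|%N.

Lemma site_norm_nbr i j : neighbors i j -> (site_norm j <= (site_norm i).+1)%N.
Proof.
move=> /neighborsP[k [b ->]]; apply/bigmax_leqP => l _.
have il : (`|i ord0 l| <= site_norm i)%N by exact: (leq_bigmax l).
by rewrite !mxE eqxx/=; case: eqP; case: b => _ /=; lia.
Qed.

Definition box n : {fset site d} :=
  [fset i | i in [seq \row_k ((f k : nat)%:Z - n%:Z) | f : {ffun 'I_d -> 'I_(n.*2.+1)}]]%fset.

Lemma mem_box n i : (i \in box n) = (site_norm i <= n)%N.
Proof.
rewrite /box; apply/imfsetP/idP => /=.
  move=> [_ /mapP[f _ ->] ->]; apply/bigmax_leqP => k _; rewrite mxE.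
  by have := ltn_ord (f k); move: (nat_of_ord (f k)) => m mn; lia.
move=> /bigmax_leqP ni; exists i => //; apply/mapP.
exists [ffun k => inord `|(i ord0 k + n%:Z)%R|%N]; first by rewrite mem_enum.
apply/rowP => k; rewrite mxE ffunE.
have := ni k isT; move: (i ord0 k) => m mn.
have h1 : (`|(m + n%:Z)%R|%N < n.*2.+1)%N by lia.
rewrite (inordK h1); lia.
Qed.

Lemma sub_box (L : {fset site d}) : exists N, forall n, (N <= n)%N -> (L `<=` box n)%fset.
Proof.
exists (\max_(i <- L) site_norm i)%N => n Nn; apply/fsubsetP => i iL.
by rewrite mem_box; apply: leq_trans Nn; exact: leq_bigmax_seq.
Qed.

End lattice_geometry.

(** * Decay of correlations under almost deterministic fields *)

Section contraction.
Context {R : realType} (d : nat) (u : spin -> spin -> R) (lam eps : R).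
Hypothesis u_gt0 : forall a b, 0 < u a b.
Hypothesis lam_gt0 : 0 < lam.
Hypothesis lam_le1 : lam <= 1.
Hypothesis u_bnd : forall a b, lam <= u a b * u b a <= 1.
Local Notation Dg := (2 * d)%N.
Hypothesis eps_ge0 : 0 <= eps.
Hypothesis eps_small : 24 * Dg%:R * eps <= lam ^+ (6 * Dg).
Implicit Types (V U : {fset site d}) (h : site d -> spin -> R) (i j : site d).

(** The fields met in the recursion come from near-deterministic laws by
    multiplying in bonds to sites that were removed.  Each bond costs at most a
    factor lam, and a site has at most 2 d bonds.  Weighting the total mass by
    lam to the number of bonds still present gives a lower bound that is
    stable under removal of sites, U being the region before the removal. *)
Definition admissible U V h := forall j, j \in V ->
  [/\ forall b, 0 <= h j b,
      forall b b', b != b' -> h j b * h j b' <= eps &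
      lam ^+ Dg <= lam ^+ count (mem U) (nbrs j) * \sum_b h j b].

Let cross i j a b : R := bond_weight u i j a b * bond_weight u j i b a.

Let cross_bnd i j a b : lam <= cross i j a b <= 1.
Proof.
rewrite /cross /bond_weight neighbors_sym.
by case: ifP => _; rewrite ?u_bnd// mulr1 lexx andbT.
Qed.

Let cross_ge0 i j a b : 0 <= cross i j a b.
Proof. by have /andP[+ _] := cross_bnd i j a b; apply: le_trans; exact: ltW. Qed.

Let cross1 i j a b : ~~ neighbors i j -> cross i j a b = 1.
Proof.
by rewrite /cross /bond_weight (neighbors_sym j i) => /negbTE ->; rewrite mulr1.
Qed.

(** Interpolation between the fields produced by the spins c' and c at i: the
    bonds from i to the sites in s already see c, the others still see c'. *)
Definition mixed_field h i (s : seq (site d)) c c' : site d -> spin -> R :=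
  fun j b => h j b * cross i j (if j \in s then c else c') b.

(** Removing i lowers by one the number of bonds of each of its neighbours and
    multiplies their fields by at least lam, so the two effects cancel in the
    mass bound. *)
Lemma admissible_mixed V h i s c c' : i \notin V -> admissible (i |` V)%fset V h ->
  admissible V V (mixed_field h i s c c').
Proof.
move=> iV hok j jV; have [h0 hp hs] := hok j jV; split=> [b|b b' bb'|].
- by rewrite /mixed_field mulr_ge0.
- apply: le_trans (hp _ _ bb').
  have x b1 : mixed_field h i s c c' j b1 <= h j b1.
    by rewrite /mixed_field ler_piMr//; have /andP[] := cross_bnd i j (if j \in s then c else c') b1.
  by rewrite ler_pM// /mixed_field mulr_ge0.
apply: le_trans hs _.
have -> : count (mem (i |` V)%fset) (nbrs j) =
          (neighbors i j + count (mem V) (nbrs j))%N.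
  rewrite neighbors_sym -mem_nbrs -(count_uniq_mem i (nbrs_uniq j)).
  rewrite -count_predUI (_ : count (predI _ _) _ = 0%N) ?addn0.
    by apply: eq_count => k; rewrite !inE.
  apply/eqP; rewrite -leqn0 leqNgt -has_count; apply/hasPn => k _ /=.
  by apply/negP => /andP[/eqP -> ]; exact/negP.
rewrite exprD [_ ^+ neighbors i j * _]mulrC -mulrA ler_wpM2l ?exprn_ge0 ?(ltW lam_gt0)//.
rewrite big_distrr/=; apply: ler_sum => b _.
rewrite /mixed_field mulrC ler_wpM2l//.
case: (boolP (neighbors i j)) => ij; last by rewrite cross1.
by rewrite expr1; have /andP[] := cross_bnd i j (if j \in s then c else c') b.
Qed.

Section fixed_site.
Variables (V : {fset site d}) (i : site d) (h : site d -> spin -> R).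
Variables (c c' : spin).
Hypothesis iV : i \notin V.
Hypothesis hok : admissible (i |` V)%fset V h.

Let T s := partition_fun u V (mixed_field h i s c c').

Lemma admissible_partition_gt0 U V1 h1 : admissible U V1 h1 -> 0 < partition_fun u V1 h1.
Proof.
move=> ok1; apply: partition_fun_gt0 => // [j b jV|j jV].
  by have [] := ok1 j jV.
have [_ _ hs] := ok1 j jV.
by have := lt_le_trans (exprn_gt0 Dg lam_gt0) hs; rewrite pmulr_rgt0 ?exprn_gt0.
Qed.

Lemma mixed_gt0 s : 0 < T s.
Proof. exact: (admissible_partition_gt0 (admissible_mixed s c c' iV hok)). Qed.

Let cond_at j s b := partition_fun u (V `\ j)%fset (field_add u (mixed_field h i s c c') j b).

Lemma field_add_mix h1 j b : field_add u h1 j b = mixed_field h1 j [::] b b.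
Proof. by []. Qed.

Lemma cond_at_gt0 j s b : j \in V -> 0 < cond_at j s b.
Proof.
move=> jV; have jV' : j \notin (V `\ j)%fset by rewrite !inE eqxx.
apply: (@admissible_partition_gt0 (V `\ j)%fset); rewrite field_add_mix; apply: admissible_mixed => //.
rewrite fsetD1K// => k; rewrite !inE => /andP[_ kV].
exact: (admissible_mixed s c c' iV hok kV).
Qed.

(** Moving j into s changes the field at j alone.  Expanding both partition
    functions at j therefore gives sums with the same conditioned weights. *)
Lemma mixed_cons j s : j \in V -> j \notin s ->
  T (j :: s) = \sum_b h j b * cross i j c b * cond_at j s b /\
  T s = \sum_b h j b * cross i j c' b * cond_at j s b.
Proof.
move=> jV js; rewrite /T !(partition_fun_fsetD1 _ _ jV); split; apply: eq_bigr => b _.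
  rewrite {1}/mixed_field mem_head; congr (_ * _); apply: eq_partition_fun => k.
  rewrite !inE => /andP[kj _]; apply/funext => a.
  by rewrite /field_add /mixed_field inE (negbTE kj).
by rewrite {1}/mixed_field (negbTE js).
Qed.

Let f j s := T (j :: s) / T s.

Lemma mixed_step_bnd j s : j \in V -> j \notin s -> lam <= f j s <= lam^-1.
Proof.
move=> jV js; have [T1 T2] := mixed_cons jV js; have [h0 _ _] := hok jV.
rewrite /f ler_pdivlMr ?mixed_gt0// ler_pdivrMr ?mixed_gt0//.
rewrite [X in _ && (_ <= X)]mulrC ler_pdivlMr// T1 T2 mulrC !mulr_suml.
apply/andP; split; apply: ler_sum => b _; have xb := ltW (cond_at_gt0 s b jV).
  have /andP[c1 _] := cross_bnd i j c b; have /andP[_ c2] := cross_bnd i j c' b.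
  rewrite mulrAC ler_wpM2r// -mulrA ler_wpM2l//.
  by apply: le_trans c1; rewrite ler_piMl// ltW.
have /andP[c1 _] := cross_bnd i j c' b; have /andP[_ c2] := cross_bnd i j c b.
rewrite mulrAC ler_wpM2r// -mulrA ler_wpM2l//.
by apply: le_trans c1; rewrite ler_piMl// ltW.
Qed.

Lemma mixed_bnd s : {subset s <= V} -> uniq s ->
  lam ^+ size s <= T s / T [::] <= lam ^- size s.
Proof.
elim: s => [|j s ih] sV; first by rewrite divff ?gt_eqF ?mixed_gt0// expr0 invr1 lexx.
move=> /andP[js us].
have jV : j \in V by rewrite sV ?mem_head.
have /andP[l1 l2] := ih (fun k ks => sV k (mem_behead (s := j :: s) ks)) us.
have -> : T (j :: s) / T [::] = f j s * (T s / T [::]).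
  by rewrite /f; field; rewrite !gt_eqF ?mixed_gt0.
have /andP[f1 f2] := mixed_step_bnd jV js.
rewrite exprS invfM !ler_pM ?invr_ge0 ?exprn_ge0 ?(ltW lam_gt0)//.
- by apply: le_trans f1; exact: ltW.
- by apply: le_trans l1; rewrite exprn_ge0 ?ltW.
Qed.

(** Sites of V which are not neighbours of i do not feel its spin, so the
    interpolation only has to run through the neighbours. *)
Lemma mixed_full : T [seq j <- nbrs i | j \in V] = partition_fun u V (field_add u h i c).
Proof.
apply: eq_partition_fun => j jV; apply/funext => b; rewrite /mixed_field mem_filter jV mem_nbrs/=.
by case: ifPn => // ij; rewrite /field_add -/(cross i j c b) !cross1.
Qed.

End fixed_site.

(** The partition function of V when an additional site i has spin b.  The
    field at i itself is left out, so that it depends on the other sites only. *)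
Definition conditioned V i h b := partition_fun u V (field_add u h i b).

Lemma conditioned_gt0 V i h b : i \notin V -> admissible (i |` V)%fset V h -> 0 < conditioned V i h b.
Proof. by move=> iV hok; exact: (mixed_gt0 b b iV hok [::]). Qed.

Lemma conditioned_bnd V i h c c' : i \notin V -> admissible (i |` V)%fset V h ->
  lam ^+ Dg <= conditioned V i h c / conditioned V i h c' <= lam ^- Dg.
Proof.
move=> iV hok; rewrite /conditioned -(mixed_full V i h c c').
set s := [seq _ <- _ | _].
have sV : {subset s <= V} by move=> j; rewrite mem_filter => /andP[].
have us : uniq s by rewrite filter_uniq// nbrs_uniq.
have /andP[l1 l2] := mixed_bnd c c' iV hok sV us.
have sD : (size s <= Dg)%N.
  by apply: leq_trans (size_nbrs i); rewrite size_filter count_size.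
have lD : lam ^+ Dg <= lam ^+ size s by rewrite ler_wiXn2l ?(ltW lam_gt0).
apply/andP; split; first exact: le_trans l1.
by apply: le_trans l2 _; rewrite lef_pV2 ?posrE ?exprn_gt0.
Qed.

Let A := lam ^- Dg.
Let m := lam ^+ (2 * Dg).

(** The regions V and V' and their fields are only compared within distance n of
    i, so the bound expresses loss of memory of the far region and of the
    boundary condition at once.  In the induction the ratio for the spin at i is
    a product over its neighbours; every factor is a quotient to which
    [ratio_contract] applies, its vectors r and r' being ratios at a neighbour j in
    regions without i, which agree within distance n - 1 of j. *)
Lemma ratio_decay n V V' i h h' : i \notin V -> i \notin V' ->
  admissible (i |` V)%fset V h -> admissible (i |` V')%fset V' h' ->
  (forall j, (site_norm j <= site_norm i + n)%N ->
     (j \in V) = (j \in V') /\ (j \in V -> h j = h' j)) ->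
  forall c c', `|conditioned V i h c / conditioned V i h c' - conditioned V' i h' c / conditioned V' i h' c'| <= A * 2^-1 ^+ n.
Proof.
elim: n V V' i h h' => [|n ih] V V' i h h' iV iV' hok hok' agree c c'.
  have /andP[a1 a2] := conditioned_bnd c c' iV hok; have /andP[b1 b2] := conditioned_bnd c c' iV' hok'.
  have p0 : 0 < lam ^+ Dg by rewrite exprn_gt0.
  rewrite expr0 mulr1 /A; apply/ler_normlP; split; lra.
(* bound on the variation of the factor of a single neighbour *)
pose e := 12 * eps * A * (A * 2^-1 ^+ n) / m ^+ 2.
pose T s := partition_fun u V (mixed_field h i s c c'); pose T' s := partition_fun u V' (mixed_field h' i s c c').
(* telescoping over the neighbours of i, with the Leibniz rule for differences *)
have step s : {subset s <= [predI V & nbrs i]} -> uniq s ->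
    `|T s / T [::] - T' s / T' [::]| <= (size s)%:R * (lam ^- size s * e).
  elim: s => [|j s ihs] sV; first by rewrite !divff ?gt_eqF ?mixed_gt0// subrr normr0 mul0r.
  move=> /andP[js us].
  have /andP[/= jV]: j \in [predI V & nbrs i] by rewrite sV ?mem_head.
  rewrite mem_nbrs => ij.
  have sV1 : {subset s <= [predI V & nbrs i]} by move=> k ks; rewrite sV// inE ks orbT.
  have {}ihs := ihs sV1 us.
  have [VV' hh'] : (j \in V) = (j \in V') /\ (j \in V -> h j = h' j).
    by apply: agree; rewrite addnS (leq_trans (site_norm_nbr ij))// ltnS leq_addr.
  have jV' : j \in V' by rewrite -VV'.
  have {hh'} hh' : h j = h' j by exact: hh'.
  pose r b := conditioned (V `\ j)%fset j (mixed_field h i s c c') b /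
              conditioned (V `\ j)%fset j (mixed_field h i s c c') spin_zero.
  pose r' b := conditioned (V' `\ j)%fset j (mixed_field h' i s c c') b /
               conditioned (V' `\ j)%fset j (mixed_field h' i s c c') spin_zero.
  pose x b := h j b * cross i j c b.
  pose y b := h j b * cross i j c' b.
  have okj (W : {fset site d}) g : i \notin W -> admissible (i |` W)%fset W g -> j \in W ->
      admissible (j |` (W `\ j))%fset (W `\ j)%fset (mixed_field g i s c c').
    move=> iW okW jW; rewrite fsetD1K// => k; rewrite !inE => /andP[_ kW].
    exact: (admissible_mixed s c c' iW okW kW).
  have nj (W : {fset site d}) : j \notin (W `\ j)%fset by rewrite !inE eqxx.
  have fE (W : {fset site d}) g (iW : i \notin W) (okW : admissible (i |` W)%fset W g) (jW : j \in W) :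
      partition_fun u W (mixed_field g i (j :: s) c c') / partition_fun u W (mixed_field g i s c c') =
      (\sum_b g j b * cross i j c b * (conditioned (W `\ j)%fset j (mixed_field g i s c c') b /
              conditioned (W `\ j)%fset j (mixed_field g i s c c') spin_zero)) /
      (\sum_b g j b * cross i j c' b * (conditioned (W `\ j)%fset j (mixed_field g i s c c') b /
              conditioned (W `\ j)%fset j (mixed_field g i s c c') spin_zero)).
    have [-> ->] := mixed_cons i g c c' jW js.
    under [in RHS]eq_bigr do rewrite mulrA.
    under [X in _ = _ / X]eq_bigr do rewrite mulrA.
    rewrite -!mulr_suml -mulf_div divff ?mulr1//.
    by rewrite invr_eq0 gt_eqF// conditioned_gt0//; exact: okj.
  have A0 : 0 < A by rewrite invr_gt0 exprn_gt0.
  have rA (W : {fset site d}) g (iW : i \notin W) (okW : admissible (i |` W)%fset W g) (jW : j \in W) b :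
      A^-1 <= conditioned (W `\ j)%fset j (mixed_field g i s c c') b /
              conditioned (W `\ j)%fset j (mixed_field g i s c c') spin_zero <= A.
    by rewrite invrK; apply: conditioned_bnd => //; exact: okj.
  have mM (W : {fset site d}) g (iW : i \notin W) (okW : admissible (i |` W)%fset W g) (jW : j \in W) :
      m <= \sum_b g j b * cross i j c' b *
        (conditioned (W `\ j)%fset j (mixed_field g i s c c') b /
              conditioned (W `\ j)%fset j (mixed_field g i s c c') spin_zero).
    apply: (@le_trans _ _ (\sum_b g j b * cross i j c' b * A^-1)).
      rewrite -mulr_suml /m mul2n -addnn exprD invrK ler_wpM2r ?exprn_ge0 ?(ltW lam_gt0)//.
      have [y0 _ ys] := admissible_mixed s c c' iW okW jW.
      move: ys; rewrite /mixed_field (negbTE js) => ys; apply: le_trans ys _.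
      rewrite ler_piMl ?sumr_ge0//; last by rewrite exprn_ile1 ?(ltW lam_gt0).
      by move=> b _; have := y0 b; rewrite /mixed_field (negbTE js).
    have [g0 _ _] := okW j jW.
    apply: ler_sum => b _; rewrite ler_wpM2l ?(mulr_ge0 (g0 b) (cross_ge0 _ _ _ _))//.
    by have /andP[] := rA W g iW okW jW b.
  have m0 : 0 < m by rewrite exprn_gt0.
  have ff' : `|partition_fun u V (mixed_field h i (j :: s) c c') / T s -
               partition_fun u V' (mixed_field h' i (j :: s) c c') / T' s| <= e.
    rewrite /T /T' !fE// -hh'.
    have [h0 hp _] := hok j jV.
    apply: ratio_contract => //.
    - by move=> b; exact: mulr_ge0 (h0 b) (cross_ge0 _ _ _ _).
    - by move=> b; exact: mulr_ge0 (h0 b) (cross_ge0 _ _ _ _).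
    - move=> b b' bb'; apply: le_trans (hp _ _ bb').
      have c1 a a' : h j a * cross i j a' a <= h j a.
        by rewrite ler_piMr//; have /andP[] := cross_bnd i j a' a.
      by apply: ler_pM (c1 _ _) (c1 _ _); exact: mulr_ge0 (h0 _) (cross_ge0 _ _ _ _).
    - move=> b; have /andP[r1 ->] := rA V h iV hok jV b; rewrite andbT.
      by apply: lt_le_trans r1; rewrite invr_gt0.
    - move=> b; have /andP[r1 ->] := rA V' h' iV' hok' jV' b; rewrite andbT.
      by apply: lt_le_trans r1; rewrite invr_gt0.
    - move=> b; apply: ih; [exact: nj|exact: nj|exact: okj|exact: okj|].
      move=> k kj; have [kV kh] : (k \in V) = (k \in V') /\ (k \in V -> h k = h' k).
        by apply: agree; rewrite (leq_trans kj)// addnS -addSn leq_add2r site_norm_nbr.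
      rewrite !inE kV; split=> // /andP[_ kV']; apply/funext => a.
      by rewrite /mixed_field kh// kV.
    - exact: mM.
    - by rewrite hh'; exact: mM.
  have e0 : 0 <= e by apply: le_trans ff'.
  have sV2 : {subset s <= V} by move=> k /sV1 /andP[].
  have -> : T (j :: s) / T [::] = (T (j :: s) / T s) * (T s / T [::]).
    by field; rewrite !gt_eqF ?mixed_gt0.
  have -> : T' (j :: s) / T' [::] = (T' (j :: s) / T' s) * (T' s / T' [::]).
    by field; rewrite !gt_eqF ?mixed_gt0.
  have /andP[f1 f2] := mixed_step_bnd c c' iV' hok' jV' js.
  have /andP[t1 t2] := mixed_bnd c c' iV hok sV2 us.
  move: ff' ihs f1 f2 t1 t2.
  rewrite -/(T s) -/(T' s) -/(T' (j :: s)) -/(T (j :: s)) -/(T [::]) -/(T' [::]).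
  set a := T (j :: s) / T s; set a' := T' (j :: s) / T' s.
  set b := T s / T [::]; set b' := T' s / T' [::].
  clearbody a a' b b'; move=> aa' bb' f1 f2 t1 t2.
  have -> : a * b - a' * b' = (a - a') * b + a' * (b - b') by ring.
  apply: le_trans (ler_normD _ _) _; rewrite !normrM.
  have a'0 : 0 < a' by exact: lt_le_trans f1.
  have b0 : 0 < b by apply: lt_le_trans t1; rewrite exprn_gt0.
  rewrite (gtr0_norm b0) (gtr0_norm a'0).
  apply: (@le_trans _ _ (e * lam ^- size s + lam^-1 * ((size s)%:R * (lam ^- size s * e)))).
    by rewrite lerD// ler_pM// ltW.
  rewrite /= exprS invfM -natr1 mulrDl mul1r addrC lerD//.
    by rewrite mulrCA !mulrA.
  rewrite mulrC -[X in _ <= X]mulrA ler_peMl ?mulr_ge0 ?invr_ge0 ?exprn_ge0 ?(ltW lam_gt0)//.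
  by rewrite -invr1 lef_pV2 ?posrE.
(* the neighbours lie within distance n + 1, where both regions coincide *)
have sE : [seq j <- nbrs i | j \in V'] = [seq j <- nbrs i | j \in V].
  apply: eq_in_filter => j; rewrite mem_nbrs => ij.
  by have [] := agree j _; rewrite // addnS (leq_trans (site_norm_nbr ij))// ltnS leq_addr.
rewrite /conditioned -(mixed_full V i h c c') -(mixed_full V' i h' c c') sE.
set s := [seq _ <- _ | _].
have sV : {subset s <= [predI V & nbrs i]}.
  by move=> j; rewrite mem_filter => /andP[? ?]; rewrite inE/=; apply/andP.
have us : uniq s by rewrite filter_uniq// nbrs_uniq.
have := step s sV us; rewrite -/(T s) -/(T' s) => st; apply: le_trans st _.
have sD : (size s <= Dg)%N.
  by apply: leq_trans (size_nbrs i); rewrite size_filter count_size.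
have L0 : 0 < lam ^+ Dg by rewrite exprn_gt0.
have e0 : 0 <= e.
  by rewrite /e /A /m !mulr_ge0 ?invr_ge0 ?exprn_ge0 ?invr_ge0 ?exprn_ge0 ?(ltW lam_gt0).
apply: (@le_trans _ _ (Dg%:R * (A * e))).
  rewrite ler_pM ?ler_nat ?mulr_ge0 ?invr_ge0 ?exprn_ge0 ?(ltW lam_gt0)//.
  rewrite ler_wpM2r// lef_pV2 ?posrE ?exprn_gt0//.
  by rewrite ler_wiXn2l ?(ltW lam_gt0).
(* the smallness of eps is exactly what makes the last factor at most 1 *)
have -> : Dg%:R * (A * e) = A * 2^-1 ^+ n.+1 * (24 * Dg%:R * eps / lam ^+ (6 * Dg)).
  rewrite /e /A /m [2^-1 ^+ n.+1]exprS.
  have -> : lam ^+ (2 * Dg) = (lam ^+ Dg) ^+ 2 by rewrite mulnC exprM.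
  have -> : lam ^+ (6 * Dg) = (lam ^+ Dg) ^+ 6 by rewrite mulnC exprM.
  move: (lam ^+ Dg) (2^-1 ^+ n) L0 => x y x0.
  by field; rewrite gt_eqF.
rewrite ler_piMr ?mulr_ge0 ?invr_ge0 ?exprn_ge0 ?invr_ge0 ?(ltW lam_gt0)//.
by rewrite ler_pdivrMr ?exprn_gt0// mul1r.
Qed.
End contraction.

(** * Families which converge uniformly in the boundary condition *)

Section uniform_limits.
Context {R : realType} {C : Type}.

(** The boundary conditions w and w' may differ: the common limit is then
    independent of the boundary condition. *)
Definition ucauchy (T : Type) (F : nat -> C -> T -> R) := forall e : R, 0 < e ->
  exists N, forall n m, (N <= n)%N -> (N <= m)%N -> forall w w' x,
    `|F n w x - F m w' x| <= e.

(** Two-sided bounds make this class stable under products and normalisation. *)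
Definition tame (T : Type) (F : nat -> C -> T -> R) := ucauchy F /\
  exists2 B : R, 0 < B & exists N, forall n, (N <= n)%N -> forall w x,
    B^-1 <= F n w x <= B.

Lemma tame_comp (T T' : Type) (F : nat -> C -> T -> R) (g : T' -> T) :
  tame F -> tame (fun n w x => F n w (g x)).
Proof.
move=> [uF [B B0 [N FB]]]; split; last by exists B => //; exists N => n Nn w x; exact: FB.
by move=> e /uF[M FM]; exists M => n m Mn Mm w w' x; exact: FM.
Qed.

Lemma tame_mul (T : Type) (F G : nat -> C -> T -> R) :
  tame F -> tame G -> tame (fun n w x => F n w x * G n w x).
Proof.
move=> [uF [A A0 [N FA]]] [uG [B B0 [M GB]]]; split; last first.
  exists (A * B); first exact: mulr_gt0.
  exists (maxn N M) => n; rewrite geq_max => /andP[Nn Mn] w x.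
  have /andP[f1 f2] := FA n Nn w x; have /andP[g1 g2] := GB n Mn w x.
  have a0 : 0 <= A^-1 by rewrite invr_ge0 ltW.
  have b0 : 0 <= B^-1 by rewrite invr_ge0 ltW.
  rewrite invfM; apply/andP; split; apply: ler_pM => //.
    exact: le_trans f1.
  exact: le_trans g1.
move=> e e0.
have [P FP] := uF (e / (2 * B)) (divr_gt0 e0 (mulr_gt0 (ltr0Sn R 1) B0)).
have [Q GQ] := uG (e / (2 * A)) (divr_gt0 e0 (mulr_gt0 (ltr0Sn R 1) A0)).
exists (maxn (maxn N M) (maxn P Q)) => n m.
rewrite !geq_max => /andP[/andP[Nn Mn] /andP[Pn Qn]] /andP[/andP[Nm Mm] /andP[Pm Qm]].
move=> w w' x.
have := FP n m Pn Pm w w' x; have := GQ n m Qn Qm w w' x.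
have /andP[f1 f2] := FA m Nm w' x; have /andP[g1 g2] := GB n Mn w x.
have {}f1 : 0 < F m w' x by apply: lt_le_trans f1; rewrite invr_gt0.
have {}g1 : 0 < G n w x by apply: lt_le_trans g1; rewrite invr_gt0.
set f := F n w x in f2 *; set f' := F m w' x in f1 f2 *.
set g := G n w x in g1 g2 *; set g' := G m w' x => gg' ff'.
have -> : f * g - f' * g' = (f - f') * g + f' * (g - g') by ring.
apply: le_trans (ler_normD _ _) _; rewrite !normrM (gtr0_norm f1) (gtr0_norm g1).
apply: (@le_trans _ _ (e / (2 * B) * B + A * (e / (2 * A)))).
  by rewrite lerD// ler_pM// ltW.
by rewrite le_eqVlt; apply/orP; left; apply/eqP; field; rewrite !gt_eqF.
Qed.

(** Numerator and denominator are averages of the same family F with the same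
    weights c, and the difference of two such quotients is again a
    combination of cross differences of F.  Weights c i = 0 are harmless. *)
Lemma ucauchy_normalize (T : Type) (I : finType) (c : I -> R)
    (F : nat -> C -> T * I -> R) :
  (forall i, 0 <= c i) -> \sum_i c i = 1 -> tame F ->
  ucauchy (fun n w (x : T * I) => c x.2 * F n w x / \sum_i c i * F n w (x.1, i)).
Proof.
move=> c0 c1 [uF [B B0 [N FB]]] e e0.
have [M FM] := uF (e / (2 * B ^+ 3)) (divr_gt0 e0 (mulr_gt0 (ltr0Sn R 1) (exprn_gt0 3 B0))).
exists (maxn N M) => n m; rewrite !geq_max => /andP[Nn Mn] /andP[Nm Mm] w w' [x i].
have S n1 w1 : (N <= n1)%N -> B^-1 <= \sum_j c j * F n1 w1 (x, j).
  move=> Nn1; rewrite -[leLHS]mul1r -c1 mulr_suml; apply: ler_sum => j _.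
  by rewrite ler_wpM2l//; have /andP[] := FB n1 Nn1 w1 (x, j).
have /= {S} := (S n w Nn, S m w' Nm); set a := \sum_j _; set b := \sum_j _.
move=> [Ba Bb].
have Bi : 0 < B^-1 by rewrite invr_gt0.
have a0 : 0 < a by exact: lt_le_trans Ba.
have b0 : 0 < b by exact: lt_le_trans Bb.
set f := F n w; set f' := F m w'.
have -> : c i * f (x, i) / a - c i * f' (x, i) / b =
   c i * (f (x, i) * b - f' (x, i) * a) / (a * b) by field; rewrite !gt_eqF.
have k : `|f (x, i) * b - f' (x, i) * a| <= e / B ^+ 2.
  have -> : f (x, i) * b - f' (x, i) * a =
      \sum_j c j * (f (x, i) * f' (x, j) - f' (x, i) * f (x, j)).
    by rewrite /a /b !mulr_sumr -sumrB; apply: eq_bigr => j _; rewrite /f /f'; ring.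
  apply: le_trans (ler_norm_sum _ _ _) _.
  rewrite -[leRHS]mul1r -c1 mulr_suml; apply: ler_sum => j _.
  rewrite normrM (ger0_norm (c0 j)) ler_wpM2l//.
  have -> : f (x, i) * f' (x, j) - f' (x, i) * f (x, j) =
    (f (x, i) - f' (x, i)) * f' (x, j) + f' (x, i) * (f' (x, j) - f (x, j)) by ring.
  apply: le_trans (ler_normD _ _) _; rewrite !normrM (distrC (f' (x, j))).
  have /andP[p1 p2] := FB m Nm w' (x, i); have /andP[q1 q2] := FB m Nm w' (x, j).
  have p0 := lt_le_trans Bi p1; have q0 := lt_le_trans Bi q1.
  rewrite (gtr0_norm p0) (gtr0_norm q0).
  apply: (@le_trans _ _ (e / (2 * B ^+ 3) * B + B * (e / (2 * B ^+ 3)))).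
    by rewrite lerD// ler_pM ?(ltW p0) ?(ltW q0)// FM.
  by rewrite le_eqVlt; apply/orP; left; apply/eqP; field; rewrite gt_eqF.
have ci : c i <= 1.
  by rewrite -c1 (bigD1 i)//= lerDl sumr_ge0.
rewrite !normrM normfV (gtr0_norm (mulr_gt0 a0 b0)) (ger0_norm (c0 i)).
rewrite ler_pdivrMr ?mulr_gt0//.
apply: (@le_trans _ _ (1 * (e / B ^+ 2))); first by rewrite ler_pM.
rewrite mul1r ler_wpM2l ?(ltW e0)// -exprVn expr2 ler_pM// ltW//.
Qed.

Lemma ucauchy_lim (T : Type) (F : nat -> C -> T -> R) (w0 : C) : ucauchy F ->
  exists f : T -> R, forall e : R, 0 < e -> exists N, forall n, (N <= n)%N ->
    forall w x, `|F n w x - f x| <= e.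
Proof.
move=> uF.
have cF x : cvgn (fun n => F n w0 x).
  apply: cauchy_cvg; apply/cauchy_exP => e e0.
  have [N FN] := uF (e / 2) (divr_gt0 e0 (ltr0Sn R 1)).
  exists (F N w0 x); exists N => // n /= Nn; rewrite /ball/=.
  apply: le_lt_trans (FN N n (leqnn _) Nn w0 w0 x) _.
  by rewrite ltr_pdivrMr// ltr_pMr// ltr1n.
exists (fun x => limn (fun n => F n w0 x)) => e e0.
have [N FN] := uF (e / 2) (divr_gt0 e0 (ltr0Sn R 1)).
exists N => n Nn w x.
have /cvgrPdist_le/(_ _ (divr_gt0 e0 (ltr0Sn R 1)))[M _ FM] := cF x.
have := FM (maxn N M) (leq_maxr _ _); have := FN n (maxn N M) Nn (leq_maxl _ _) w w0 x.
move=> h1 h2; rewrite [X in X - _](_ : _ = F n w x - F (maxn N M) w0 x + F (maxn N M) w0 x); last by ring.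
rewrite -addrA; apply: le_trans (ler_normD _ _) _.
by rewrite [leRHS](splitr e) lerD// distrC.
Qed.

End uniform_limits.

(** * Convergence of finite-volume conditional probabilities *)

Section finite_volume.
Context {R : realType} (d : nat) (u : spin -> spin -> R) (lam eps : R).
Hypothesis u_gt0 : forall a b, 0 < u a b.
Hypothesis lam_gt0 : 0 < lam.
Hypothesis lam_le1 : lam <= 1.
Hypothesis u_bnd : forall a b, lam <= u a b * u b a <= 1.
Local Notation Dg := (2 * d)%N.
Hypothesis eps_ge0 : 0 <= eps.
Hypothesis eps_small : 24 * Dg%:R * eps <= lam ^+ (6 * Dg).
Variable q : spin -> spin -> R.
Hypothesis q_ge0 : forall a b, 0 <= q a b.
Hypothesis q_sum1 : forall a, \sum_b q a b = 1.
Hypothesis q_small : forall a b b', b != b' -> q a b * q a b' <= eps.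
Implicit Types (V : {fset site d}) (w eta : config d) (i j : site d).

(** The field acting on the initial spins: the law of the spin at j given its
    value eta j at time t, times the bonds to the boundary condition w. *)
Definition pinned_field V w eta : site d -> spin -> R := fun j b =>
  q (eta j) b * \prod_(k <- nbrs j | k \notin V) (u b (w k) * u (w k) b).

Lemma admissible_pinned_field V w eta : admissible lam eps V V (pinned_field V w eta).
Proof.
move=> j jV.
have p0 b : 0 <= \prod_(k <- nbrs j | k \notin V) (u b (w k) * u (w k) b).
  by apply: prodr_ge0 => k _; rewrite mulr_ge0 ?(ltW (u_gt0 _ _)).
split=> [b|b b' bb'|]; first by rewrite mulr_ge0.
  apply: le_trans (q_small _ bb').
  have c1 a : pinned_field V w eta j a <= q (eta j) a.
    rewrite ler_piMr// prodr_ile1// => k _.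
    by rewrite mulr_ge0 ?(ltW (u_gt0 _ _))//; have /andP[] := u_bnd a (w k).
  by rewrite ler_pM// mulr_ge0.
apply: (@le_trans _ _ (lam ^+ count (mem V) (nbrs j) *
    (\sum_b q (eta j) b * lam ^+ count (predC (mem V)) (nbrs j)))).
  rewrite -mulr_suml q_sum1 mul1r -exprD count_predC.
  by rewrite ler_wiXn2l ?(ltW lam_gt0)// size_nbrs.
rewrite ler_wpM2l ?exprn_ge0 ?(ltW lam_gt0)//; apply: ler_sum => b _.
rewrite ler_wpM2l// -sum1_count -prodrXr /=.
by apply: ler_prod => k _; rewrite expr1 (ltW lam_gt0)/=; have /andP[] := u_bnd b (w k).
Qed.

Definition pinned_partition V w eta : R := partition_fun u V (pinned_field V w eta).

Lemma pinned_partition_gt0 V w eta : 0 < pinned_partition V w eta.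
Proof. by apply: (admissible_partition_gt0 u_gt0 lam_gt0); exact: admissible_pinned_field. Qed.

Lemma eq_pinned_partition V w eta eta' : (forall j, j \in V -> eta j = eta' j) ->
  pinned_partition V w eta = pinned_partition V w eta'.
Proof. by move=> e; apply: eq_partition_fun => j jV; rewrite /pinned_field e. Qed.

Let Xn n w eta i b := conditioned u (box d n `\ i)%fset i (pinned_field (box d n) w eta) b.

(** Away from the boundary of the box the field at i is q (eta i) itself, so
    only the weights q change with eta i; the conditioned partition functions
    do not. *)
Lemma pinned_partition_set_spin n w eta i a : (site_norm i < n)%N ->
  pinned_partition (box d n) w (set_spin eta i a) = \sum_b q a b * Xn n w eta i b.
Proof.
move=> ni; have iV : i \in box d n by rewrite mem_box (ltnW ni).
rewrite /pinned_partition (partition_fun_fsetD1 _ _ iV); apply: eq_bigr => b _; congr (_ * _).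
  rewrite /pinned_field /set_spin eqxx big1_seq ?mulr1// => k.
  rewrite mem_nbrs mem_box => /andP[kn /site_norm_nbr ik]; move: kn.
  by rewrite (leq_trans ik).
apply: eq_partition_fun => j; rewrite in_fsetD1 => /andP[ji _]; apply/funext => b'.
by rewrite /field_add /pinned_field /set_spin (negbTE ji).
Qed.

Lemma set_spin_id eta i : set_spin eta i (eta i) = eta.
Proof. by apply/funext => j; rewrite /set_spin; case: eqP => // ->. Qed.

Let L := lam ^+ Dg.
Let L0 : 0 < L. Proof. by rewrite exprn_gt0. Qed.

Let okX n w eta i : (site_norm i < n)%N ->
  admissible lam eps (i |` (box d n `\ i))%fset (box d n `\ i)%fset (pinned_field (box d n) w eta).
Proof.
move=> ni; rewrite fsetD1K ?mem_box ?(ltnW ni)// => j; rewrite in_fsetD1 => /andP[_ jV].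
exact: (admissible_pinned_field w eta jV).
Qed.

Let niX n i : i \notin (box d n `\ i)%fset. Proof. by rewrite in_fsetD1 eqxx. Qed.

Let r n w eta i b := Xn n w eta i b / Xn n w eta i spin_zero.

Let r_bnd n w eta i b : (site_norm i < n)%N -> L <= r n w eta i b <= L^-1.
Proof. by move=> ni; apply: (conditioned_bnd _ _ _ _ _ _ _ (okX w eta ni)). Qed.

Let rho n w (x : config d * spin) i :=
  pinned_partition (box d n) w (set_spin x.1 i x.2) / pinned_partition (box d n) w x.1.

Let rhoE n w x i : (site_norm i < n)%N ->
  rho n w x i = (\sum_b q x.2 b * r n w x.1 i b) / (\sum_b q (x.1 i) b * r n w x.1 i b).
Proof.
move=> ni; rewrite /rho -[in X in _ / X](set_spin_id x.1 i) !pinned_partition_set_spin//.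
under [in RHS]eq_bigr do rewrite mulrA.
under [X in _ = _ / X]eq_bigr do rewrite mulrA.
rewrite -!mulr_suml -mulf_div divff ?mulr1//.
rewrite invr_eq0 gt_eqF//; apply: (conditioned_gt0 _ _ _ _ _ _ (okX w x.1 ni)) => //.
Qed.

Let avg_bnd n w eta i a : (site_norm i < n)%N ->
  L <= \sum_b q a b * r n w eta i b <= L^-1.
Proof.
move=> ni; apply/andP; split.
  rewrite -[leLHS]mul1r -(q_sum1 a) mulr_suml; apply: ler_sum => b _.
  by rewrite ler_wpM2l//; have /andP[] := r_bnd w eta b ni.
rewrite -[leRHS]mul1r -(q_sum1 a) mulr_suml; apply: ler_sum => b _.
by rewrite ler_wpM2l//; have /andP[] := r_bnd w eta b ni.
Qed.

(** The ratio is a quotient of averages of the vector of [ratio_decay]; here the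
    weights need not be small, since the decay has already been gained. *)
Lemma tame_rho i : tame (fun n w x => rho n w x i).
Proof.
split; last first.
  exists (L^-1 ^+ 2); first by rewrite exprn_gt0 ?invr_gt0.
  exists (site_norm i).+1 => n ni w x; rewrite rhoE//.
  have /andP[a1 a2] := avg_bnd w x.1 x.2 ni.
  have /andP[b1 b2] := avg_bnd w x.1 (x.1 i) ni.
  have b0 := lt_le_trans L0 b1.
  rewrite -exprVn invrK !expr2; apply/andP; split; apply: ler_pM => //.
  - exact: ltW.
  - exact: ltW.
  - by rewrite -[X in X <= _]invrK lef_pV2 ?posrE ?invr_gt0.
  - by apply: le_trans a1; exact: ltW.
  - by rewrite invr_ge0 ltW.
  - by rewrite lef_pV2 ?posrE.
move=> e e0.
pose K := 12 * L^-1 * L^-1 / L ^+ 2.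
have K0 : 0 < K by rewrite /K !mulr_gt0 ?invr_gt0 ?exprn_gt0.
have [p Kp] : exists p, K * 2^-1 ^+ p <= e.
  have h2 : `|2^-1 : R| < 1 by rewrite gtr0_norm ?invr_gt0// invf_lt1// ltr1n.
  have /cvgrPdist_le/(_ _ (divr_gt0 e0 K0))[p _ /(_ p (leqnn _))] := cvg_expr h2.
  rewrite sub0r normrN ger0_norm ?exprn_ge0 ?invr_ge0// => pK; exists p.
  by rewrite mulrC -ler_pdivlMr.
(* the box must contain the neighbours of all sites within distance p of i *)
exists (site_norm i + p).+1 => n m np mp w w' x.
have ni : (site_norm i < n)%N by rewrite (leq_trans _ np)// ltnS leq_addr.
have mi : (site_norm i < m)%N by rewrite (leq_trans _ mp)// ltnS leq_addr.
rewrite !rhoE//; apply: le_trans Kp.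
have rA n1 w1 b : (site_norm i < n1)%N -> 0 < r n1 w1 x.1 i b <= L^-1.
  by move=> ni1; have /andP[r1 ->] := r_bnd w1 x.1 b ni1; rewrite (lt_le_trans L0 r1).
have /andP[b1 _] := avg_bnd w x.1 (x.1 i) ni.
have /andP[b2 _] := avg_bnd w' x.1 (x.1 i) mi.
apply: le_trans (ratio_contract (th := 1) (A := L^-1) (e := L^-1 * 2^-1 ^+ p) _ _ _ _ _ _ L0 b1 b2) _ => //.
- move=> b b' _; rewrite -[leRHS]mulr1; apply: ler_pM => //.
    by rewrite -(q_sum1 x.2) (bigD1 b)//= lerDl sumr_ge0.
  by rewrite -(q_sum1 (x.1 i)) (bigD1 b')//= lerDl sumr_ge0.
- by move=> b; exact: rA.
- by move=> b; exact: rA.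
- move=> b; have agree : forall j, (site_norm j <= site_norm i + p)%N ->
      (j \in box d n `\ i)%fset = (j \in box d m `\ i)%fset /\
      ((j \in box d n `\ i)%fset ->
        pinned_field (box d n) w x.1 j = pinned_field (box d m) w' x.1 j); last first.
    exact: (ratio_decay u_gt0 lam_gt0 lam_le1 u_bnd eps_ge0 eps_small (niX n i) (niX m i)
      (okX w x.1 ni) (okX w' x.1 mi) agree b spin_zero).
  move=> j jp; rewrite !in_fsetD1 !mem_box.
  have jn : (site_norm j < n)%N by exact: leq_ltn_trans np.
  have jm : (site_norm j < m)%N by exact: leq_ltn_trans mp.
  rewrite (ltnW jn) (ltnW jm); split=> // _; apply/funext => a; rewrite /pinned_field.
  rewrite [in LHS]big1_seq ?[in RHS]big1_seq// => k; rewrite mem_nbrs mem_box => /andP[kn /site_norm_nbr ik]; move: kn.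
    by rewrite (leq_trans ik).
  by rewrite (leq_trans ik).
by rewrite /K le_eqVlt; apply/orP; left; apply/eqP; rewrite mulr1; field; rewrite gt_eqF.
Qed.

Definition set_spins (s : seq (site d)) (z eta : config d) : config d :=
  fun j => if j \in s then z j else eta j.

(** A change at finitely many sites is a composition of changes at single
    sites, hence the ratio is a product of single-site ratios. *)
Lemma tame_ratio s : tame (fun n w (x : config d * config d) =>
  pinned_partition (box d n) w (set_spins s x.2 x.1) / pinned_partition (box d n) w x.1).
Proof.
elim: s => [|i s ih].
  have e n w (x : config d * config d) : pinned_partition (box d n) w (set_spins [::] x.2 x.1) / pinned_partition (box d n) w x.1 = 1.
    by rewrite divff ?gt_eqF ?pinned_partition_gt0.
  split; last by exists 1 => //; exists 0%N => n _ w x; rewrite e invr1 lexx.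
  by move=> e1 e0; exists 0%N => n m _ _ w w' x; rewrite !e subrr normr0 ltW.
have -> : (fun n w (x : config d * config d) =>
    pinned_partition (box d n) w (set_spins (i :: s) x.2 x.1) / pinned_partition (box d n) w x.1) =
  (fun n w (x : config d * config d) =>
    rho n w (set_spins s x.2 x.1, x.2 i) i *
    (pinned_partition (box d n) w (set_spins s x.2 x.1) / pinned_partition (box d n) w x.1)).
  apply/funext => n; apply/funext => w; apply/funext => x.
  have -> : set_spins (i :: s) x.2 x.1 = set_spin (set_spins s x.2 x.1) i (x.2 i).
    by apply/funext => j; rewrite /set_spins /set_spin inE; case: eqP => //= ->.
  by rewrite /rho/=; field; rewrite !gt_eqF ?pinned_partition_gt0.
apply: tame_mul ih.
exact: (tame_comp (fun x : config d * config d => (set_spins s x.2 x.1, x.2 i)) (tame_rho i)).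
Qed.

Variable c : spin -> R.
Hypothesis c_ge0 : forall a, 0 <= c a.
Hypothesis c_sum1 : \sum_a c a = 1.

Definition site_weight (D : {fset site d}) eta : R := \prod_(i <- D) c (eta i).

(** With Y the pinned partition function of a box, this is the conditional
    law at time t of the spins in D given those of eta off D, for initial spins
    which are subject to a boundary condition. *)
Definition finite_cond (Y : config d -> R) (D : {fset site d}) eta
    (v : {ffun D -> spin}) : R :=
  site_weight D (concat_config v eta) * Y (concat_config v eta) /
  sum_on D (fun s => site_weight D s * Y s) eta.

Lemma site_weightE (D : {fset site d}) (v : {ffun D -> spin}) eta :
  site_weight D (concat_config v eta) = \prod_x c (v x).
Proof.
rewrite /site_weight big_seq_fsetE/=; apply: eq_bigr => x _; by rewrite concat_in.
Qed.

Lemma site_weight_sum1 (D : {fset site d}) : \sum_(v : {ffun D -> spin}) \prod_x c (v x) = 1.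
Proof.
rewrite -(bigA_distr_bigA (fun _ a => c a)) big1// => x _; exact: c_sum1.
Qed.

Lemma finite_cond_lim (D : {fset site d}) : exists g : config d -> {ffun D -> spin} -> R,
  forall e : R, 0 < e -> exists N, forall n, (N <= n)%N ->
    forall w eta v, `|finite_cond (pinned_partition (box d n) w) eta v - g eta v| <= e.
Proof.
pose F n w (x : config d * {ffun D -> spin}) :=
  pinned_partition (box d n) w (concat_config x.2 x.1) / pinned_partition (box d n) w x.1.
have tF : tame F.
  have -> : F = (fun n w (x : config d * {ffun D -> spin}) =>
    pinned_partition (box d n) w (set_spins D (concat_config x.2 x.1) x.1) / pinned_partition (box d n) w x.1).
    apply/funext => n; apply/funext => w; apply/funext => x; congr (pinned_partition _ _ _ / _).
    by apply/funext => j; rewrite /set_spins; case: ifPn => // jD; rewrite concat_out.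
  exact: (tame_comp (fun x : config d * {ffun D -> spin} => (x.1, concat_config x.2 x.1)) (tame_ratio D)).
have cp (v : {ffun D -> spin}) : 0 <= \prod_x c (v x) by exact: prodr_ge0.
have /(ucauchy_lim ((fun=> spin_zero) : config d))[g gP] :=
  ucauchy_normalize (c := fun v : {ffun D -> spin} => \prod_x c (v x)) cp (site_weight_sum1 D) tF.
exists (fun eta v => g (eta, v)) => e /gP[N gN]; exists N => n Nn w eta v.
have := gN n Nn w (eta, v); congr (`|_ - _| <= _).
rewrite /finite_cond site_weightE /sum_on /F/=.
have -> : \sum_(w0 : {ffun D -> spin}) site_weight D (concat_config w0 eta) * pinned_partition (box d n) w (concat_config w0 eta)
  = (\sum_(i : {ffun D -> spin}) (\prod_x c (i x)) * (pinned_partition (box d n) w (concat_config i eta) / pinned_partition (box d n) w eta)) * pinned_partition (box d n) w eta.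
  rewrite mulr_suml; apply: eq_bigr => v' _; rewrite site_weightE -!mulrA mulVf ?mulr1//.
  by rewrite gt_eqF ?pinned_partition_gt0.
by rewrite invfM mulrA mulrAC !mulrA.
Qed.

End finite_volume.

(** * Functions of finitely many spins and quasilocality *)

Definition depends_on d (J : set (site d)) (T : Type) (f : config d -> T) :=
  forall w w', (forall i, J i -> w i = w' i) -> f w = f w'.

Section local.
Context (d : nat).
Implicit Types (J : set (site d)) (L : {fset site d}).

(** Sets determined by the spins in J form a sigma-algebra containing the
    generators of the sigma-field of J. *)
Lemma sigma_field_depends J (A : set (sigma_field J)) :
  measurable A -> depends_on J (A : set (config d)).
Proof.
move=> mA w w' ww'.
pose P := [set B : set (site d -> spin) | depends_on J (B : set (config d))].
have cyl : cylinders J `<=` P.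
  by move=> _ [i Ji [B ->]] v v' vv'; rewrite /= vv'.
suff sa : sigma_algebra setT P by exact: (smallest_sub sa cyl mA).
split=> [v v' _|B dB v v' vv'|F dF v v' vv'] //=.
  by rewrite /setD/= (dB _ _ vv').
by apply/propext; split => -[n _ Fn]; exists n => //; move: Fn; rewrite (dF n _ _ vv').
Qed.

Lemma measurable_depends L J (A : set (config d)) : [set` L] `<=` J ->
  depends_on [set` L] A -> measurable (A : set (sigma_field J)).
Proof.
move=> LJ dA.
pose o : config d := fun=> spin_zero.
have -> : A = \bigcup_(v in [set v : {ffun L -> spin} | A (concat_config v o)])
    pinned L (concat_config v o).
  apply/seteqP; split => w /=.
    move=> Aw; exists (restr L w) => /=.
      rewrite (dA _ w)// => i /= iL; by rewrite concat_restr iL.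
    by move=> i iL; rewrite concat_restr iL.
  by move=> [v Av wv]; rewrite (dA w (concat_config v o)).
apply: fin_bigcup_measurable; first exact: finite_finset.
move=> v _.
rewrite (_ : pinned _ _ = \bigcap_(i in [set` L]) [set w | w i = concat_config v o i]); last first.
  by apply/seteqP; split.
apply: fin_bigcap_measurable; first exact: finite_fset.
move=> i iL; apply: sub_sigma_algebra; exists i; first exact: LJ.
by exists [set concat_config v o i].
Qed.

Lemma measurable_fun_depends L J (R : realType) (f : config d -> R) :
  [set` L] `<=` J -> depends_on [set` L] f ->
  measurable_fun [set: sigma_field J] (f : sigma_field J -> R).
Proof.
move=> LJ df _ B mB; rewrite setTI; apply: (measurable_depends LJ).
by move=> w w' ww'; rewrite /preimage/= (df w w').
Qed.

Lemma sigma_field_sub J (A : set (sigma_field J)) :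
  measurable A -> measurable (A : set (config d)).
Proof.
apply: sub_sigma_algebra2.
by move=> _ [i Ji [B ->]]; exists i => //; exists B.
Qed.

Lemma local_functionP (R : realType) (f : config d -> R) :
  local_function f <-> exists L, depends_on [set` L] f.
Proof.
split=> [[L mf]|[L df]]; exists L; last exact: measurable_fun_depends df.
move=> w w' ww'.
have := mf measurableT [set f w] (measurable_set1 _); rewrite setTI.
by move=> /sigma_field_depends/(_ _ _ ww')/= /[!propeqE] -[/(_ erefl) <-].
Qed.

Lemma depends_bounded (R : realType) L (f : config d -> R) :
  depends_on [set` L] f -> exists B, forall w, `|f w| <= B.
Proof.
move=> df; pose o : config d := fun=> spin_zero.
exists (\sum_(v : {ffun L -> spin}) `|f (concat_config v o)|) => w.
rewrite (bigD1 (restr L w))//= (df w (concat_config (restr L w) o)).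
  by rewrite lerDl sumr_ge0.
by move=> i /= iL; rewrite concat_restr iL.
Qed.

Lemma uniform_cvgP (R : realType) (g : nat -> config d -> R) f :
  {uniform, g @ \oo --> f} <->
  forall e : R, 0 < e -> \forall n \near \oo, forall w, `|f w - g n w| <= e.
Proof.
split=> [gf e e0|h].
  have : nbhs (f : {uniform _ -> R}) [set h : config d -> R | forall w, `|f w - h w| <= e].
    apply/uniform_nbhs; exists [set xy | ball xy.1 e xy.2]; split.
      exact: (entourage_ball R (PosNum e0)).
    by move=> h /= fh w; apply: ltW; have := fh w I.
  by move=> /gf.
move=> P /uniform_nbhs[E []]; rewrite -entourage_ballE => -[/= e e0 eE] EP.
have /h : 0 < e / 2 by rewrite divr_gt0.
apply: filterS => n fg; apply: EP => w _; apply: eE; rewrite /ball/=.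
apply: le_lt_trans (fg w) _.
by rewrite ltr_pdivrMr// ltr_pMr// ltr1n.
Qed.

(** One approximation for each precision suffices: countable choice assembles
    them into a sequence. *)
Lemma quasilocalP (R : realType) (f : config d -> R) :
  quasilocal_function f <-> forall e : R, 0 < e ->
    exists L, exists2 h : config d -> R, depends_on [set` L] h &
      forall w, `|f w - h w| <= e.
Proof.
split=> [[g [lg /uniform_cvgP gf]] e e0|h].
  have [n _ /(_ n (leqnn _)) fg] := gf e e0.
  by have /local_functionP[L Lg] := lg n; exists L, (g n).
have n0 n : 0 < n.+1%:R^-1 :> R by rewrite invr_gt0.
have /choice[g gP] : forall n : nat, exists g : config d -> R,
    local_function g /\ forall w, `|f w - g w| <= n.+1%:R^-1.
  move=> n; have [L [g Lg fg]] := h _ (n0 n).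
  by exists g; split=> //; apply/local_functionP; exists L.
exists g; split=> [n|]; first by have [] := gP n.
apply/uniform_cvgP => e e0; near=> n => w.
apply: le_trans (proj2 (gP n) w) _; apply: ltW.
by near: n; exact: near_infty_natSinv_lt (PosNum e0).
Unshelve. all: by end_near. Qed.

Lemma quasilocal_measurable (R : realType) (f : config d -> R) :
  quasilocal_function f -> measurable_fun [set: config d] f.
Proof.
move=> [g [lg /uniform_cvgP gf]].
apply: (measurable_fun_cvg (h := g)) => [n|w _].
  have /local_functionP[L Lg] := lg n.
  by apply: (measurable_fun_depends (L := L)) Lg.
apply/cvgrPdist_le => e e0; apply: filterS (gf e e0) => n; exact.
Qed.

Lemma quasilocal_bounded (R : realType) (f : config d -> R) :
  quasilocal_function f -> exists B, forall w, `|f w| <= B.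
Proof.
move=> /quasilocalP/(_ 1 ltr01)[L [h /depends_bounded[B hB] fh]].
exists (1 + B) => w; rewrite -[f w](subrK (h w)).
by apply: le_trans (ler_normD _ _) _; rewrite lerD.
Qed.

End local.

(** * Finite mixtures of point masses *)

Section mixture.
Context (R : realType) (d : nat) (I : finType).
Variables (p : I -> R) (x : I -> config d).
Hypothesis p_ge0 : forall i, 0 <= p i.
Hypothesis p_sum1 : \sum_i p i = 1.

Let i0 : I.
Proof.
apply: (@xchoose _ predT); apply: contrapT => /forallNP h.
have := p_sum1; rewrite big1 => [/eqP|i _]; first by rewrite eq_sym oner_eq0.
by have := h i.
Qed.

Let nt k := nth i0 (enum I) k.

Let P0 : {measure set (config d) -> \bar R} :=
  msum (fun k => mscale (NngNum (p_ge0 (nt k))) \d_(x (nt k))) #|I|.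

Let sum_nt (F : I -> \bar R) : (\sum_(k < #|I|) F (nt k) = \sum_i F i)%E.
Proof.
rewrite -[RHS]big_enum/= (big_nth i0) big_mkord -cardE.
by apply: eq_bigr.
Qed.

Let P0E A : P0 A = (\sum_i (p i)%:E * \d_(x i) A)%E.
Proof. by rewrite -sum_nt. Qed.

(** The weighted sum of Dirac masses has total mass 1; normalising it changes
    no value and packages it as a probability measure. *)
Lemma mixture_exists : exists P : probability (config d) R,
  forall A, P A = (\sum_i (p i)%:E * \d_(x i) A)%E.
Proof.
exists (mnormalize P0 \d_point) => A; rewrite -P0E.
have P0T : P0 setT = 1%E.
  by rewrite P0E; under eq_bigr do rewrite diracT mule1; rewrite sumEFin p_sum1.
have E B : mnormalize P0 \d_point B = P0 B.
  by rewrite /mnormalize P0T onee_eq0/= invr1 mule1.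
exact: E.
Qed.

Lemma ge0_integral_mixture (P : probability (config d) R) (f : config d -> \bar R) :
  (forall A, P A = (\sum_i (p i)%:E * \d_(x i) A)%E) ->
  measurable_fun [set: config d] f -> (forall w, 0 <= f w)%E ->
  (\int[P]_w f w = \sum_i (p i)%:E * f (x i))%E.
Proof.
move=> PE mf f0; rewrite (@eq_measure_integral _ _ _ _ P0); last first.
  by move=> A _ _; rewrite P0E; exact: PE.
rewrite ge0_integral_measure_sum// -sum_nt; apply: eq_bigr => k _.
by rewrite ge0_integral_mscale//= integral_dirac// diracT mul1e.
Qed.

Lemma Rintegral_mixture (P : probability (config d) R) (f : config d -> R) :
  (forall A, P A = (\sum_i (p i)%:E * \d_(x i) A)%E) ->
  measurable_fun [set: config d] f ->
  \int[P]_w f w = \sum_i p i * f (x i).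
Proof.
move=> PE mf; rewrite /Rintegral integralE.
rewrite !(ge0_integral_mixture PE)//; last 2 first.
- exact/measurable_funeneg/measurable_EFinP.
- exact/measurable_funepos/measurable_EFinP.
under eq_bigr do rewrite funeposE -EFin_max -EFinM.
under [X in (_ - X)%E]eq_bigr do rewrite funenegE -EFinN -EFin_max -EFinM.
rewrite !sumEFin -EFinB/= -sumrB; apply: eq_bigr => i _.
rewrite -mulrBr; congr (_ * _); move: (f (x i)) => y.
have [y0|/ltW y0] := leP 0 y.
  by rewrite (max_idPr _) ?subr0// oppr_le0.
by rewrite (max_idPl _) ?sub0r ?opprK// oppr_ge0.
Qed.

End mixture.

(** * Consistency of conditional averages *)

Section averages.
Context {R : realType} (d : nat) (c : spin -> R).
Hypothesis c_ge0 : forall a, 0 <= c a.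
Hypothesis c_sum1 : \sum_a c a = 1.
Variable Y : config d -> R.
Hypothesis Y_gt0 : forall s, 0 < Y s.
Implicit Types (D L : {fset site d}) (eta s : config d) (F : config d -> R).

Let W D s := site_weight c D s * Y s.

Lemma joint_weight_ge0 D s : 0 <= W D s.
Proof. by rewrite /W mulr_ge0 ?prodr_ge0// ltW. Qed.

Lemma sum_on_joint_weight_gt0 D eta : 0 < sum_on D (W D) eta.
Proof.
rewrite lt0r sumr_ge0 => [|v _]; last exact: joint_weight_ge0.
rewrite andbT; apply/negP; rewrite psumr_eq0 => [/allP h|v _]; last exact: joint_weight_ge0.
have := site_weight_sum1 c_sum1 D; rewrite big1 => [/eqP|v _]; first by rewrite eq_sym oner_eq0.
have := h v (mem_index_enum _); rewrite /= /W site_weightE mulf_eq0 (gt_eqF (Y_gt0 _)) orbF.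
by move/eqP.
Qed.

Lemma finite_cond_ge0 D eta (v : {ffun D -> spin}) : 0 <= finite_cond c Y eta v.
Proof. by rewrite divr_ge0 ?(joint_weight_ge0 D)// ltW// (sum_on_joint_weight_gt0 D). Qed.

Lemma finite_cond_sum1 D eta : \sum_(v : {ffun D -> spin}) finite_cond c Y eta v = 1.
Proof. by rewrite -mulr_suml divff// gt_eqF// (sum_on_joint_weight_gt0 D). Qed.

Lemma finite_cond_off D eta eta' (v : {ffun D -> spin}) :
  (forall i, i \notin D -> eta i = eta' i) -> finite_cond c Y eta v = finite_cond c Y eta' v.
Proof. by move=> e; rewrite /finite_cond (concat_eq_off v e) (sum_on_eq_off _ e). Qed.

(** The spins in D are integrated out and the weight Y only sees V, so only
    the spins in V off D are left. *)
Lemma finite_cond_depends V D (v : {ffun D -> spin}) : depends_on [set` V] Y ->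
  depends_on [set` (V `\` D)%fset] (fun eta => finite_cond c Y eta v).
Proof.
move=> dY eta eta' e /=.
pose eta2 : config d := fun i => if i \in D then eta i else eta' i.
rewrite -(@finite_cond_off D eta2 eta'); last by move=> i iD; rewrite /eta2 (negbTE iD).
have e2 i : i \in V -> eta i = eta2 i.
  move=> iV; rewrite /eta2; case: ifPn => // iD; apply: e => /=.
  by rewrite in_fsetD iD.
have cY (v' : {ffun D -> spin}) : Y (concat_config v' eta) = Y (concat_config v' eta2).
  apply: dY => i /= iV; case: (boolP (i \in D)) => iD; first exact: concat_eq_in.
  by rewrite !concat_out// e2.
rewrite /finite_cond !site_weightE cY; congr (_ / _).
by apply: eq_bigr => v' _; rewrite !site_weightE cY.
Qed.

Definition cond_avg (D : {fset site d}) F eta : R :=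
  \sum_(v : {ffun D -> spin}) finite_cond c Y eta v * F (concat_config v eta).

Lemma cond_avgE D F eta :
  cond_avg D F eta * sum_on D (W D) eta = sum_on D (fun s => W D s * F s) eta.
Proof.
rewrite /cond_avg mulr_suml; apply: eq_bigr => v _.
by rewrite /finite_cond mulrAC divfK// gt_eqF// (sum_on_joint_weight_gt0 D).
Qed.

Lemma cond_avg_concat D (v : {ffun D -> spin}) F eta :
  cond_avg D F (concat_config v eta) = cond_avg D F eta.
Proof.
apply: eq_bigr => v' _; rewrite concat_concat; congr (_ * _).
by apply: finite_cond_off => i iD; rewrite concat_out.
Qed.

Lemma joint_weight_sub D L : (D `<=` L)%fset -> forall s,
  W L s = site_weight c (L `\` D)%fset s * W D s.
Proof.
move=> DL s; rewrite /W mulrA; congr (_ * _).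
rewrite /site_weight (big_fsetID _ (mem D))/= mulrC; congr (_ * _).
  by apply: eq_fbigl => i; rewrite !inE/= andbC.
apply: eq_fbigl => i; rewrite !inE/= andb_idl//.
exact: (fsubsetP DL).
Qed.

(** Sum over the spins in D first.  The average over D and the site weights off
    D do not depend on these spins, and the sum of the remaining weights times
    the average gives back the weighted sum of F.  Taking L to be a whole box,
    this is the DLR equation in finite volume. *)
Lemma sum_on_cond_avg D L F eta : (D `<=` L)%fset ->
  sum_on L (fun s => W L s * cond_avg D F s) eta = sum_on L (fun s => W L s * F s) eta.
Proof.
move=> DL; rewrite !(sum_on_sub _ _ DL); apply: eq_sum_on => w.
set s := concat_config w eta.
have C v : site_weight c (L `\` D)%fset (concat_config (v : {ffun D -> spin}) s) =
           site_weight c (L `\` D)%fset s.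
  rewrite /site_weight !big_seq; apply: eq_bigr => i; rewrite in_fsetD => /andP[iD _].
  by rewrite concat_out.
transitivity (site_weight c (L `\` D)%fset s * (cond_avg D F s * sum_on D (W D) s)).
  rewrite /sum_on !mulr_sumr; apply: eq_bigr => v _.
  by rewrite (joint_weight_sub DL) C cond_avg_concat -mulrA; congr (_ * _); rewrite mulrC.
rewrite cond_avgE /sum_on mulr_sumr; apply: eq_bigr => v _.
by rewrite (joint_weight_sub DL) C mulrA.
Qed.

Lemma cond_avg_avg D L F eta : (D `<=` L)%fset -> cond_avg L (cond_avg D F) eta = cond_avg L F eta.
Proof.
move=> DL; apply: (mulIf (lt0r_neq0 (sum_on_joint_weight_gt0 L eta))).
by rewrite !cond_avgE sum_on_cond_avg.
Qed.

End averages.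

(** * The limiting specification *)

Lemma eq_small (R : realType) (x y : R) :
  (forall e, 0 < e -> `|x - y| <= e) -> x = y.
Proof.
move=> h; apply/eqP; rewrite -subr_eq0 -normr_le0.
by apply/ler_addgt0Pr => e e0; rewrite add0r h.
Qed.

Section limit_specification.
Context {R : realType} (d : nat) (c : spin -> R).
Hypothesis c_ge0 : forall a, 0 <= c a.
Hypothesis c_sum1 : \sum_a c a = 1.
Variable Y : nat -> config d -> config d -> R.
Hypothesis Y_gt0 : forall n w s, 0 < Y n w s.
Hypothesis Y_depends : forall n w, depends_on [set` box d n] (Y n w).
Variable g : forall D : {fset site d}, config d -> {ffun D -> spin} -> R.
Hypothesis gP : forall D (e : R), 0 < e -> exists N, forall n, (N <= n)%N ->
  forall w eta v, `|finite_cond c (Y n w) eta v - @g D eta v| <= e.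
Implicit Types (D L : {fset site d}) (eta s w : config d) (F : config d -> R).

Let gf_ge0 n w := finite_cond_ge0 c_ge0 c_sum1 (Y_gt0 n w).
Let gf_sum1 n w := finite_cond_sum1 c_ge0 c_sum1 (Y_gt0 n w).
Let o : config d := fun=> spin_zero.

Definition limit_avg D F eta : R :=
  \sum_(v : {ffun D -> spin}) g eta v * F (concat_config v eta).

(** Uniformity in F is what allows replacing one conditional average inside
    another by its finite-volume version. *)
Lemma limit_avg_close D (e : R) : 0 < e -> exists N, forall n, (N <= n)%N ->
  forall w eta F (B : R), (forall s, `|F s| <= B) ->
    `|cond_avg c (Y n w) D F eta - limit_avg D F eta| <= e * B.
Proof.
move=> e0; pose K : R := #|{ffun D -> spin}|%:R.
have K0 : 0 < K by rewrite ltr0n; apply/card_gt0P; exists [ffun=> spin_zero].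
have [N gN] := gP D (divr_gt0 e0 K0).
exists N => n Nn w eta F B FB.
rewrite -sumrB; apply: le_trans (ler_norm_sum _ _ _) _.
apply: (@le_trans _ _ (\sum_(v : {ffun D -> spin}) e / K * B)).
  by apply: ler_sum => v _; rewrite -mulrBl normrM ler_pM// gN.
rewrite sumr_const -[X in X <= _]mulr_natl -/K.
by rewrite mulrA mulrCA divff ?mulr1// gt_eqF.
Qed.

Lemma limit_cond_ge0 D eta (v : {ffun D -> spin}) : 0 <= g eta v.
Proof.
apply/ler_addgt0Pr => e e0; have [N gN] := gP D e0.
have := gN N (leqnn _) o eta v; have := gf_ge0 N o eta v.
by move=> h1 /ler_normlP[h2 h3]; lra.
Qed.

Lemma limit_cond_sum1 D eta : \sum_(v : {ffun D -> spin}) g eta v = 1.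
Proof.
apply: eq_small => e e0; have [N gN] := limit_avg_close D e0.
have := gN N (leqnn _) o eta (fun=> 1) 1 (fun=> ltac:(by rewrite normr1)).
rewrite /limit_avg /cond_avg mulr1 distrC; congr (`|_ - _| <= _).
  by apply: eq_bigr => v _; rewrite mulr1.
by rewrite -[RHS](gf_sum1 N o D eta); apply: eq_bigr => v _; rewrite mulr1.
Qed.

Lemma cond_avg_le n w D F eta (B : R) : (forall s, `|F s| <= B) -> `|cond_avg c (Y n w) D F eta| <= B.
Proof.
move=> FB; apply: le_trans (ler_norm_sum _ _ _) _.
rewrite -[leRHS]mul1r -(gf_sum1 n w D eta) mulr_suml; apply: ler_sum => v _.
by rewrite normrM ger0_norm ?gf_ge0// ler_wpM2l// gf_ge0.
Qed.

Lemma limit_avg_le D F eta (B : R) : (forall s, `|F s| <= B) -> `|limit_avg D F eta| <= B.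
Proof.
move=> FB; apply: le_trans (ler_norm_sum _ _ _) _.
rewrite -[leRHS]mul1r -(limit_cond_sum1 D eta) mulr_suml; apply: ler_sum => v _.
by rewrite normrM ger0_norm ?limit_cond_ge0// ler_wpM2l// limit_cond_ge0.
Qed.

Lemma limit_avgB D F G eta : limit_avg D (fun s => F s - G s) eta = limit_avg D F eta - limit_avg D G eta.
Proof. by rewrite /limit_avg -sumrB; apply: eq_bigr => v _; rewrite mulrBr. Qed.

(** Exact in finite volume; averages do not increase the sup norm, so the three
    replacements of limits by finite-volume averages cost e / 3 each. *)
Lemma limit_avg_avg D L F eta : (D `<=` L)%fset -> (forall s, `|F s| <= 1) ->
  limit_avg L (limit_avg D F) eta = limit_avg L F eta.
Proof.
move=> DL F1; apply: eq_small => e e0.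
have e3 : 0 < e / 3 by rewrite divr_gt0.
have [N cN] := limit_avg_close D e3; have [M cM] := limit_avg_close L e3.
have Nn := leq_maxl N M; have Mn := leq_maxr N M; move: (maxn N M) Nn Mn => n Nn Mn.
pose Q := cond_avg c (Y n o).
have h1 : `|limit_avg L (fun s => limit_avg D F s - Q D F s) eta| <= e / 3.
  by apply: limit_avg_le => s; rewrite distrC -[leRHS]mulr1; exact: cN.
have h2 : `|Q L (Q D F) eta - limit_avg L (Q D F) eta| <= e / 3 * 1.
  by apply: cM => // s; exact: cond_avg_le.
have h3 : `|Q L F eta - limit_avg L F eta| <= e / 3 * 1 by exact: cM.
move: h1 h2 h3; rewrite limit_avgB /Q (cond_avg_avg c_ge0 c_sum1 (Y_gt0 n o) _ _ DL) !mulr1.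
move=> /ler_normlP[a1 a2] /ler_normlP[b1 b2] /ler_normlP[k1 k2].
apply/ler_normlP; split; lra.
Qed.

(** Only the spins in D are resampled, so the kernel is a finite mixture of
    point masses. *)
Definition limit_kernel : kernel_family R d := fun D eta =>
  get [set P : probability (config d) R |
    forall A, P A = (\sum_(v : {ffun D -> spin}) (g eta v)%:E * \d_(concat_config v eta) A)%E].

Lemma limit_kernel_diracE D eta A : limit_kernel D eta A =
  (\sum_(v : {ffun D -> spin}) (g eta v)%:E * \d_(concat_config v eta) A)%E.
Proof.
have ex := mixture_exists (fun v : {ffun D -> spin} => concat_config v eta) (fun v => limit_cond_ge0 eta v) (limit_cond_sum1 D eta).
exact: (getPex ex A).
Qed.

Lemma limit_kernelE D eta A : limit_kernel D eta A = (limit_avg D \1_A eta)%:E.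
Proof.
rewrite limit_kernel_diracE /limit_avg -sumEFin; apply: eq_bigr => v _.
by rewrite EFinM diracE indicE.
Qed.

Lemma measurable_limit_cond D (v : {ffun D -> spin}) :
  measurable_fun [set: sigma_field (~` [set` D])] (fun eta => g eta v).
Proof.
apply: (@measurable_fun_cvg _ (sigma_field (~` [set` D])) R setT
  (fun n (eta : config d) => finite_cond c (Y n o) eta v) (fun eta : config d => g eta v)) => [n|eta _].
  apply: (measurable_fun_depends (L := (box d n `\` D)%fset)).
    by move=> i /=; rewrite in_fsetD => /andP[/negP].
  exact: finite_cond_depends.
apply/cvgrPdist_le => e /(gP D)[N gN]; exists N => // n /= Nn.
by rewrite distrC; exact: gN.
Qed.

Lemma measurable_concat D (v : {ffun D -> spin}) :
  measurable_fun [set: sigma_field (~` [set` D])]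
    (concat_config v : sigma_field (~` [set` D]) -> config d).
Proof.
apply: (@measurability _ _ _ (config d) setT _ (cylinders [set: site d])) => //.
move=> _ [_ [i _ [B ->]] <-]; rewrite setTI.
have [iD|iD] := boolP (i \in D).
  have -> : concat_config v @^-1` [set w | B (w i)] =
      if `[<B (concat_config v o i)>] then setT else set0.
    apply/seteqP; split => w /=; case: asboolP => //=; rewrite (concat_eq_in v w o iD)//.
  by case: ifP.
apply: sub_sigma_algebra; exists i; first exact/negP.
by exists B; apply/seteqP; split => w /=; rewrite concat_out.
Qed.

Lemma measurable_limit_avg_off D A : measurable A ->
  measurable_fun [set: sigma_field (~` [set` D])] (limit_avg D \1_A).
Proof.
move=> mA; apply: measurable_sum => v.
apply: measurable_funM; first exact: measurable_limit_cond.
apply: (@measurableT_comp _ _ _ _ (config d) _ (\1_A : config d -> R)).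
  exact: measurable_indic.
exact: measurable_concat.
Qed.

Lemma measurable_limit_avg D A : measurable A ->
  measurable_fun [set: config d] (limit_avg D \1_A).
Proof.
move=> mA _ B mB; rewrite setTI; apply: (@sigma_field_sub _ (~` [set` D])).
by have := @measurable_limit_avg_off D A mA measurableT _ mB; rewrite setTI.
Qed.

Lemma limit_is_specification : is_specification limit_kernel.
Proof.
split.
- move=> D A mA.
  rewrite (_ : (fun w => _) = (fun w => (limit_avg D \1_A w)%:E)); last first.
    by apply/funext => w; rewrite limit_kernelE.
  by apply/measurable_EFinP; exact: measurable_limit_avg_off.
- move=> D B w mB; rewrite limit_kernelE; congr EFin.
  rewrite /limit_avg -[RHS]mul1r -(limit_cond_sum1 D w) mulr_suml; apply: eq_bigr => v _.
  congr (_ * _); rewrite !indicE; congr (_%:R); congr nat_of_bool.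
  apply/idP/idP; rewrite !inE /=; rewrite (sigma_field_depends mB (w' := w))//.
    by move=> i /= /negP iD; rewrite concat_out.
  by move=> i /= /negP iD; rewrite concat_out.
- move=> D L A w DL mA.
  rewrite (ge0_integral_mixture (fun v => limit_cond_ge0 w v) (limit_cond_sum1 L w) (@limit_kernel_diracE L w)).
  + rewrite limit_kernelE -(limit_avg_avg _ DL) => [|s]; last first.
      by rewrite indicE; case: (_ \in _); rewrite ?normr0 ?normr1.
    rewrite /limit_avg -sumEFin; apply: eq_bigr => v _.
    by rewrite limit_kernelE -EFinM.
  + rewrite (_ : (fun s => _) = (fun s => (limit_avg D \1_A s)%:E)); last first.
      by apply/funext => s; rewrite limit_kernelE.
    by apply/measurable_EFinP; exact: measurable_limit_avg.
  + by move=> s; exact: measure_ge0.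
Qed.

(** A finite-volume average of a function of finitely many spins depends on
    finitely many spins, and it is uniformly close to the limiting average. *)
Lemma limit_avg_quasilocal D F : quasilocal_function F -> quasilocal_function (limit_avg D F).
Proof.
move=> qF; have [B0 FB0] := quasilocal_bounded qF.
pose B := `|B0| + 1.
have B_gt0 : 0 < B by rewrite /B; have := normr_ge0 B0; lra.
have FB s : `|F s| <= B.
  by apply: le_trans (FB0 s) _; rewrite /B; have := ler_norm B0; lra.
apply/quasilocalP => e e0.
have e2 : 0 < e / 2 by rewrite divr_gt0.
have /quasilocalP/(_ _ e2)[L [h hL Fh]] := qF.
have Be : 0 < B + e / 2 by exact: addr_gt0.
have eB : 0 < e / 2 / (B + e / 2) by exact: divr_gt0.
have [N cN] := limit_avg_close D eB.
have hB s : `|h s| <= B + e / 2.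
  rewrite -[h s](subKr (F s)); apply: le_trans (ler_normB _ _) _.
  by rewrite lerD.
exists (L `|` box d N)%fset, (cond_avg c (Y N o) D h).
  move=> w w' ww'; apply: eq_bigr => v _; congr (_ * _).
    apply: (@finite_cond_depends R d c (Y N o) (box d N) D v (@Y_depends N o) w w') => i /=.
    rewrite in_fsetD => /andP[_ iN]; apply: ww'.
    by rewrite /= in_fsetU iN orbT.
  apply: hL => i /= iL; have [iD|iD] := boolP (i \in D).
    exact: concat_eq_in.
  by rewrite !concat_out//; apply: ww'; rewrite /= in_fsetU iL.
move=> w.
have h1 : `|limit_avg D (fun s => F s - h s) w| <= e / 2 by exact: limit_avg_le.
have h2 := cN N (leqnn _) o w h _ hB.
move: h1 h2; rewrite limit_avgB divfK ?gt_eqF//.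
move=> /ler_normlP[a1 a2] /ler_normlP[b1 b2].
apply/ler_normlP; split; lra.
Qed.

Lemma limit_quasilocal : quasilocal limit_kernel.
Proof.
move=> D F qF.
rewrite (_ : (fun w => _) = limit_avg D F); first exact: limit_avg_quasilocal.
apply/funext => w.
exact: (Rintegral_mixture (fun v => limit_cond_ge0 w v) (limit_cond_sum1 D w) (@limit_kernel_diracE D w) (quasilocal_measurable qF)).
Qed.

End limit_specification.

(** * The soft-core energy as a sum over oriented bonds *)

Section softcore_energy.
Context {R : realType} (d : nat).
Implicit Types (L : {fset site d}) (i j k : site d) (xi : config d).

Definition clash (a b : spin) : R := (spin_val a * spin_val b == -1)%:R.

Lemma clashC a b : clash a b = clash b a.
Proof. by rewrite /clash mulrC. Qed.

Lemma repulsion_pair i j xi : i != j ->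
  repulsion [fset i; j]%fset xi = clash (xi i) (xi j).
Proof.
move=> ij; rewrite /repulsion/clash; congr ((_ == _)%:R).
by rewrite big_fsetU1 ?inE//= big_seq_fset1.
Qed.

Lemma sum_delta (T : eqType) (s : seq T) (F : T -> R) a : uniq s ->
  \sum_(k <- s) F k * (k == a)%:R = (a \in s)%:R * F a.
Proof.
move=> us; have [aS|aS] := boolP (a \in s).
  rewrite (bigD1_seq a)//= eqxx mulr1 mul1r big1 ?addr0// => k /negbTE ->.
  by rewrite mulr0.
rewrite mul0r big_seq big1// => k ks; case: eqVneq => [ka|]; last by rewrite mulr0.
by rewrite -ka ks in aS.
Qed.

Lemma pair_eq i j k l : i != j -> k != l ->
  ([fset i; j] == [fset k; l])%fset%:R =
  (k == i)%:R * (l == j)%:R + (k == j)%:R * (l == i)%:R :> R.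
Proof.
move=> ij kl.
have h : ([fset i; j] == [fset k; l])%fset =
   ((k == i) && (l == j)) || ((k == j) && (l == i)).
  apply/eqP/orP => [e|[/andP[/eqP -> /eqP ->]|/andP[/eqP -> /eqP ->]]] //; last first.
    exact: fsetUC.
  have := fset21 k l; rewrite -e !inE; have := fset22 k l; rewrite -e !inE.
  move=> /orP[] /eqP ? /orP[] /eqP ?; subst.
  - by rewrite eqxx in kl.
  - by right; rewrite !eqxx.
  - by left; rewrite !eqxx.
  - by rewrite eqxx in kl.
have ji : (j == i) = false by rewrite eq_sym (negbTE ij).
rewrite h -!natrM -natrD; congr (_%:R).
case: (eqVneq k i) => [->|ki]; rewrite ?(negbTE ij).
  by case: (l == j).
by case: (eqVneq l j) => [->|lj]; rewrite ?ji; case: (k == j); case: (l == i).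
Qed.

Let wt L k : R := if k \in L then 2^-1 else 1.

(** A bond inside L is met from both of its ends, with weight 1/2 each; a bond
    leaving L is met from its end in L only, with weight 1. *)
Lemma bond_count L b : b \in interaction_bonds L ->
  \sum_(j <- L) \sum_(k <- nbrs j) wt L k * (b == [fset j; k]%fset)%:R = 1.
Proof.
rewrite inE => -[i0 [j0 [-> ij0 L0]]].
have ij : i0 != j0 by apply: contraTneq ij0 => ->; rewrite neighbors_irr.
transitivity (\sum_(j <- L) ((j0 \in nbrs j)%:R * wt L j0 * (j == i0)%:R +
                             (i0 \in nbrs j)%:R * wt L i0 * (j == j0)%:R)).
  apply: eq_bigr => j _; rewrite -!sum_delta ?nbrs_uniq// !mulr_suml -big_split/=.
  rewrite big_seq [RHS]big_seq; apply: eq_bigr => k; rewrite mem_nbrs => jk.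
  rewrite pair_eq//; last by apply: contraTneq jk => ->; rewrite neighbors_irr.
  ring.
rewrite big_split/= !sum_delta ?fset_uniq// !mem_nbrs ij0 neighbors_sym ij0 !mul1r.
rewrite /wt; case: (boolP (i0 \in L)) => i0L; case: (boolP (j0 \in L)) => j0L /=;
  rewrite ?mul1r ?mul0r ?addr0 ?add0r// -?splitr//.
  by rewrite -[RHS]divr1 [RHS](splitr (1 / 1)) divr1 mul1r.
by case: L0 => h; [rewrite h in i0L|rewrite h in j0L].
Qed.

Lemma energyE L xi : \sum_(b \in interaction_bonds L) repulsion (R := R) b xi =
  \sum_(j <- L) \sum_(k <- nbrs j) wt L k * clash (xi j) (xi k) :> R.
Proof.
have fin := finite_interaction_bonds L.
rewrite fsbig_finite//=.
transitivity (\sum_(b <- fset_set (interaction_bonds L)) \sum_(j <- L) \sum_(k <- nbrs j)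
    wt L k * clash (xi j) (xi k) * (b == [fset j; k]%fset)%:R).
  rewrite big_seq [RHS]big_seq; apply: eq_bigr => b; rewrite in_fset_set// => bL.
  rewrite -[LHS]mulr1 -[X in _ * X = _](bond_count bL) big_distrr/=; apply: eq_bigr => j _.
  rewrite big_distrr/= big_seq [RHS]big_seq; apply: eq_bigr => k; rewrite mem_nbrs => jk.
  have njk : j != k by apply: contraTneq jk => ->; rewrite neighbors_irr.
  case: eqP => [->|_]; last by rewrite !mulr0.
  by rewrite repulsion_pair// mulrA [X in X * _]mulrC.
rewrite exchange_big/= big_seq [RHS]big_seq; apply: eq_bigr => j jL.
rewrite exchange_big/= big_seq [RHS]big_seq; apply: eq_bigr => k; rewrite mem_nbrs => jk.
rewrite sum_delta ?fset_uniq// in_fset_set// mem_set ?mul1r//.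
by exists j, k; split=> //; left.
Qed.



End softcore_energy.

(** * Soft-core weights as products over bonds *)

Section half_bond.
Context {R : realType} (d : nat) (beta : R).
Hypothesis beta_gt0 : 0 < beta.
Implicit Types (L : {fset site d}) (i j k : site d) (xi : config d).

(** Half of the interaction, since a bond inside a region occurs there once for
    each orientation. *)
Definition half_bond (a b : spin) : R := expR (- (beta / 2) * clash a b).

Lemma half_bond_gt0 a b : 0 < half_bond a b. Proof. exact: expR_gt0. Qed.

Lemma half_bondM a b : half_bond a b * half_bond b a = expR (- beta * clash a b).
Proof.
rewrite /half_bond (clashC b a) -expRD; congr expR.
by field.
Qed.

Lemma half_bond_bnd a b :
  expR (- beta) <= half_bond a b * half_bond b a <= 1.
Proof.
have [r0 r1] : 0 <= clash a b :> R /\ clash a b <= 1 :> R.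
  by rewrite /clash ler0n lern1 leq_b1.
have b0 := ltW beta_gt0.
rewrite half_bondM; apply/andP; split.
  by rewrite ler_expR mulNr lerN2 ler_piMr.
by rewrite -[leRHS]expR0 ler_expR mulNr oppr_le0 mulr_ge0.
Qed.

Lemma expR_energyE L xi :
  expR (- beta * \sum_(b \in interaction_bonds L) repulsion (R := R) b xi) =
  \prod_(j <- L) \prod_(k <- L) bond_weight half_bond j k (xi j) (xi k) *
  \prod_(j <- L) \prod_(k <- nbrs j | k \notin L)
    (half_bond (xi j) (xi k) * half_bond (xi k) (xi j)).
Proof.
rewrite energyE big_distrr/= expR_sum -big_split/=; apply: eq_bigr => j _.
rewrite big_distrr/= expR_sum (bigID (mem L))/=; congr (_ * _).
  rewrite /bond_weight -big_mkcond/= -big_filter -[RHS]big_filter.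
  rewrite (perm_big [seq k <- L | neighbors j k]); last first.
    apply: uniq_perm; rewrite ?filter_uniq ?nbrs_uniq ?fset_uniq// => k.
    by rewrite !mem_filter mem_nbrs andbC.
  rewrite big_seq [RHS]big_seq; apply: eq_bigr => k; rewrite mem_filter => /andP[_ kL].
  by rewrite kL /half_bond; congr expR; field.
apply: eq_bigr => k /negbTE ->; rewrite half_bondM; congr expR; ring.
Qed.

End half_bond.

(** * One spin and its time evolution *)

Section single_site.
Context {R : realType} (alpha : probability spin R).

Definition spin_weight (a : spin) : R := fine (alpha [set a]).

Lemma spin_weight_ge0 a : 0 <= spin_weight a. Proof. exact: fine_ge0. Qed.

Lemma spin_weight_sum1 : \sum_a spin_weight a = 1.
Proof.
apply: EFin_inj; rewrite -sumEFin.
have <- : alpha setT = 1%E by exact: probability_setT.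
rewrite (_ : setT = \bigcup_(a in setT) [set a]); last first.
  by apply/seteqP; split => // a _; exists a.
rewrite measure_fin_bigcup//; last 2 first.
- exact: finite_finset.
- by apply/trivIsetP => x y _ _ xy; apply/seteqP; split => // z [-> yx]; move/eqP: xy.
rewrite fsbig_finite//=.
rewrite [RHS](perm_big (index_enum spin)); last first.
  apply: uniq_perm; rewrite ?fset_uniq ?index_enum_uniq// => a.
  by rewrite mem_index_enum in_fset_set ?mem_set//; exact: finite_finset.
by apply: eq_bigr => a _; rewrite /spin_weight fineK// fin_num_measure.
Qed.

Variable t : R.
Hypothesis t_gt0 : 0 < t.

(** The law at time t of a single spin started from alpha. *)
Definition evolved (a : spin) : R := \sum_b spin_weight b * transition t b a.

(** The law of the initial spin given that the spin at time t is a.  The value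
    for spins a of probability zero is a convention, chosen to be a point mass
    so that [posterior_small] holds for these as well. *)
Definition posterior (a b : spin) : R :=
  if evolved a == 0 then (b == a)%:R else spin_weight b * transition t b a / evolved a.

Let tr0 b a : 0 <= transition t b a. Proof. exact/transition_ge0/ltW. Qed.

Lemma evolved_ge0 a : 0 <= evolved a.
Proof. by apply: sumr_ge0 => b _; rewrite mulr_ge0 ?spin_weight_ge0. Qed.

Lemma evolved_sum1 : \sum_a evolved a = 1.
Proof.
rewrite exchange_big/= -spin_weight_sum1; apply: eq_bigr => b _.
by rewrite -mulr_sumr transition_sum1 mulr1.
Qed.

Lemma posterior_ge0 a b : 0 <= posterior a b.
Proof.
by rewrite /posterior; case: ifP => // _; rewrite divr_ge0 ?evolved_ge0// mulr_ge0 ?spin_weight_ge0.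
Qed.

Lemma posterior_sum1 a : \sum_b posterior a b = 1.
Proof.
rewrite /posterior; case: eqVneq => [_|h]; last by rewrite -mulr_suml divff.
by rewrite (bigD1 a)//= eqxx big1 ?addr0// => b /negbTE ->.
Qed.

(** When evolved a = 0 all terms of that sum vanish, so the identity does not
    depend on the convention made for the posterior. *)
Lemma bayes a b : spin_weight b * transition t b a = evolved a * posterior a b.
Proof.
rewrite /posterior; case: eqVneq => [h|h]; last by rewrite mulrCA divff// mulr1.
rewrite h mul0r; apply/eqP; move/eqP: h; rewrite psumr_eq0.
  by move=> /allP/(_ b (mem_index_enum _)).
by move=> b' _; rewrite mulr_ge0 ?spin_weight_ge0.
Qed.

(** A positive constant even if alpha gives no mass to one of the charged
    spins; the admissible times are proportional to it. *)
Definition spin_weight_scale : R :=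
  (if spin_weight spin_minus == 0 then 1 else spin_weight spin_minus) *
  (if spin_weight spin_plus == 0 then 1 else spin_weight spin_plus).

Lemma spin_weight_le1 a : spin_weight a <= 1.
Proof. by rewrite -spin_weight_sum1 (bigD1 a)//= lerDl sumr_ge0// => b _; exact: spin_weight_ge0. Qed.

Lemma spin_weight_scale_gt0 : 0 < spin_weight_scale.
Proof.
by rewrite /spin_weight_scale mulr_gt0//; case: eqVneq => // h; rewrite lt0r h spin_weight_ge0.
Qed.

(** Up to the scale m p, the left-hand side is the probability that the spin
    did not flip times the probability that it did.  The denominator is at
    least p (1 + x) / 2, which leaves m ^ 2 (1 - x) / (1 + x). *)
Lemma two_point_small (p m x e : R) : 0 < p -> 0 < m -> m <= 1 -> 0 <= x <= 1 ->
  e = p * (2^-1 * (1 + x)) + m * (2^-1 * (1 - x)) ->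
  (p * (2^-1 * (1 + x)) / e) * (m * (2^-1 * (1 - x)) / e) * (m * p) <= 1 - x.
Proof.
move=> p0 m0 m1 /andP[x0 x1] ee.
have pe : p * (2^-1 * (1 + x)) <= e.
  by rewrite ee lerDl !mulr_ge0//; lra.
have p20 : 0 < p * (2^-1 * (1 + x)) by rewrite !mulr_gt0//; lra.
have e0 : 0 < e by exact: lt_le_trans pe.
rewrite mulf_div mulrAC ler_pdivrMr ?mulr_gt0//.
apply: (@le_trans _ _ ((1 - x) * ((p * (2^-1 * (1 + x))) * (p * (2^-1 * (1 + x)))))); last first.
  by apply: ler_wpM2l; [lra|apply: ler_pM => //; exact: ltW].
have -> : p * (2^-1 * (1 + x)) * (m * (2^-1 * (1 - x))) * (m * p) =
  (1 - x) * (p * (2^-1 * (1 + x))) * (p * 2^-1) * (m * m) by ring.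
have -> : (1 - x) * (p * (2^-1 * (1 + x)) * (p * (2^-1 * (1 + x)))) =
  (1 - x) * (p * (2^-1 * (1 + x))) * (p * 2^-1) * (1 + x) by ring.
apply: ler_wpM2l; first by rewrite !mulr_ge0// ?(ltW p0)//; lra.
apply: (@le_trans _ _ 1); last by lra.
by rewrite -[leRHS]mulr1 ler_pM// ltW.
Qed.

(** Zeros never move, so only the charged spins compete.  If both have positive
    mass the flip probability (1 - exp (- 2 t)) / 2 <= t makes one of them
    unlikely; otherwise the initial spin is known. *)
Lemma posterior_small a b b' : b != b' ->
  posterior a b * posterior a b' <= 2 * t / spin_weight_scale.
Proof.
move=> bb'; rewrite ler_pdivlMr ?spin_weight_scale_gt0//.
have e1 : 1 - expR (- 2 * t) <= 2 * t by have := expR_ge1Dx (- 2 * t); lra.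
have e0 := expR_gt0 (- 2 * t).
have t0 := t_gt0; have e2 : expR (- 2 * t) <= 1 by rewrite -[leRHS]expR0 ler_expR; lra.
rewrite /posterior; case: eqVneq => [h|h].
  have -> : (b == a)%:R * (b' == a)%:R = 0 :> R.
    have [ba|_] := eqVneq b a; last by rewrite mul0r.
    by rewrite -ba eq_sym (negbTE bb') mulr0.
  by rewrite mul0r; lra.
have tm0 y : transition t y spin_zero = (y == spin_zero)%:R.
  by rewrite /transition; case: (spinP y) => ->; rewrite -!val_eqE/= /spin_val/=; lra.
have t0m y : y != spin_zero -> transition t spin_zero y = 0.
  by rewrite /transition; case: (spinP y) => ->; rewrite -!val_eqE/= /spin_val/=; lra.
set x := expR (- 2 * t) in e1 e0 e2.
have x01 : 0 <= x <= 1 by rewrite (ltW e0) e2.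
have tpp : transition t spin_plus spin_plus = 2^-1 * (1 + x).
  by rewrite /transition -!val_eqE/= /spin_val/= -/x; lra.
have tmm : transition t spin_minus spin_minus = 2^-1 * (1 + x).
  by rewrite /transition -!val_eqE/= /spin_val/= -/x; lra.
have tpm : transition t spin_plus spin_minus = 2^-1 * (1 - x).
  by rewrite /transition -!val_eqE/= /spin_val/= -/x; lra.
have tmp : transition t spin_minus spin_plus = 2^-1 * (1 - x).
  by rewrite /transition -!val_eqE/= /spin_val/= -/x; lra.
have zero k k' : spin_weight k * transition t k a = 0 -> 
    spin_weight k * transition t k a / evolved a * (spin_weight k' * transition t k' a / evolved a) * spin_weight_scale <= 2 * t.
  by move=> ->; rewrite !mul0r; lra.
have zeror k k' : spin_weight k' * transition t k' a = 0 ->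
    spin_weight k * transition t k a / evolved a * (spin_weight k' * transition t k' a / evolved a) * spin_weight_scale <= 2 * t.
  by move=> ->; rewrite mul0r mulr0 mul0r; lra.
have [az|az] := eqVneq a spin_zero.
  have [bz|bz] := eqVneq b spin_zero.
    by apply: zeror; rewrite az tm0 eq_sym -bz (negbTE bb') mulr0.
  by apply: zero; rewrite az tm0 (negbTE bz) mulr0.
have [bz|bz] := eqVneq b spin_zero; first by apply: zero; rewrite bz t0m// mulr0.
have [b'z|b'z] := eqVneq b' spin_zero; first by apply: zeror; rewrite b'z t0m// mulr0.
have [p0|p0] := eqVneq (spin_weight spin_plus) 0.
  case: (spinP b) bz bb' => -> // _; last by move=> _; apply: zero; rewrite p0 mul0r.
  case: (spinP b') b'z => -> // _ _; by apply: zeror; rewrite p0 mul0r.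
have [m0|m0] := eqVneq (spin_weight spin_minus) 0.
  case: (spinP b) bz bb' => -> // _; first by move=> _; apply: zero; rewrite m0 mul0r.
  case: (spinP b') b'z => -> // _ _; by apply: zeror; rewrite m0 mul0r.
have {}p0 : 0 < spin_weight spin_plus by rewrite lt0r p0 spin_weight_ge0.
have {}m0 : 0 < spin_weight spin_minus by rewrite lt0r m0 spin_weight_ge0.
rewrite /spin_weight_scale !gt_eqF//.
apply: le_trans e1.
have ep : evolved spin_plus = spin_weight spin_plus * (2^-1 * (1 + x)) + spin_weight spin_minus * (2^-1 * (1 - x)).
  by rewrite /evolved big_spin/= t0m// tpp tmp mulr0 add0r addrC.
have em : evolved spin_minus = spin_weight spin_minus * (2^-1 * (1 + x)) + spin_weight spin_plus * (2^-1 * (1 - x)).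
  by rewrite /evolved big_spin/= t0m// tmm tpm mulr0 add0r.
have hp := two_point_small p0 m0 (spin_weight_le1 _) x01 ep.
have hm := two_point_small m0 p0 (spin_weight_le1 _) x01 em.
case: (spinP a) az h => -> // _ h; case: (spinP b) bz bb' => -> // _;
  case: (spinP b') b'z => -> // _ _; rewrite ?tpp ?tmm ?tpm ?tmp.
- by rewrite [spin_weight _ * spin_weight _]mulrC.
- by rewrite [spin_weight spin_minus * spin_weight _]mulrC [X in X * _ <= _]mulrC.
- by rewrite [X in X * _ <= _]mulrC.
- by [].
Qed.

End single_site.

(** * Integrals of functions of finitely many spins *)

Section local_integral.
Context {R : realType} (d : nat).
Local Open Scope ereal_scope.

Lemma pinned_concat (V : {fset site d}) (v v' : {ffun V -> spin}) (eta eta' : config d) :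
  pinned V (concat_config v eta) (concat_config v' eta') <-> v' = v.
Proof.
split=> [h|-> i iV]; last exact: concat_eq_in.
apply/ffunP => x; have := h (val x) (valP x).
by rewrite !concat_in.
Qed.

Lemma ge0_integral_depends (P : probability (config d) R) (V : {fset site d})
    (f : config d -> R) (eta : config d) : (forall w, 0 <= f w)%R ->
  depends_on [set` V] f ->
  \int[P]_w (f w)%:E = \sum_(v : {ffun V -> spin})
    (f (concat_config v eta))%:E * P (pinned V (concat_config v eta)).
Proof.
move=> f0 fV.
transitivity (\int[P]_w (\sum_(v : {ffun V -> spin})
   (f (concat_config v eta) * \1_(pinned V (concat_config v eta)) w)%:E)).
  apply: eq_integral => w _; rewrite sumEFin; congr EFin.
  rewrite (bigD1 (restr V w))//= big1 ?addr0; last first.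
    move=> v vw; rewrite indicE memNset ?mulr0// => wv.
    move/eqP: vw; apply; apply/ffunP => x; rewrite ffunE.
    by rewrite (wv (val x) (valP x)) concat_in.
  rewrite indicE mem_set ?mulr1; last by move=> i iV; rewrite concat_restr iV.
  by apply: fV => i /= iV; rewrite concat_restr iV.
rewrite ge0_integral_sum//; last 2 first.
- move=> v; apply/measurable_EFinP; apply: measurable_funM; first exact: measurable_cst.
  apply: measurable_indic; exact: measurable_pinned.
- by move=> v w _; rewrite lee_fin mulr_ge0.
apply: eq_bigr => v _.
under eq_integral do rewrite EFinM.
rewrite ge0_integralZl_EFin//; last first.
  by apply/measurable_EFinP/measurable_indic; exact: measurable_pinned.
by rewrite integral_indic ?setIT//; exact: measurable_pinned.
Qed.

End local_integral.

(** * Cylinder probabilities of the evolved measure *)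

Section evolved_cylinders.
Context {R : realType} (d : nat) (beta : R) (alpha : probability spin R).
Context (t : {posnum R}).
Local Notation u := (half_bond beta).
Local Notation q := (posterior alpha t%:num).
Local Notation c := (evolved alpha t%:num).

(** Bayes' formula at every site of V moves the spins at time t into the
    fields of the partition function of the initial spins. *)
Lemma softcore_evolved (V : {fset site d}) (w z : config d) :
  \sum_(v : {ffun V -> spin}) softcore_weight beta alpha w v *
    \prod_(i <- V) transition t%:num (concat_config v w i) (z i) =
  site_weight c V z * pinned_partition u q V w z.
Proof.
rewrite /pinned_partition /partition_fun /sum_on mulr_sumr; apply: eq_bigr => v _.
rewrite /softcore_weight expR_energyE /gibbs_weight.
set xi := concat_config v w; set s := concat_config v _.
have sE j : j \in V -> s j = xi j by move=> jV; exact: concat_eq_in.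
have -> : \prod_(i : V) fine (alpha [set v i]) = \prod_(i <- V) spin_weight alpha (xi i).
  by rewrite [RHS]big_seq_fsetE/=; apply: eq_bigr => x _; rewrite /xi concat_in.
rewrite -!mulrA -big_split/=.
have -> : \prod_(i <- V) (spin_weight alpha (xi i) * transition t%:num (xi i) (z i)) =
    site_weight c V z * \prod_(i <- V) q (z i) (xi i).
  by rewrite /site_weight -big_split/=; apply: eq_bigr => i _; rewrite bayes.
have -> : \prod_(j <- V) pinned_field u q V w z j (s j) =
    \prod_(i <- V) q (z i) (xi i) *
    \prod_(j <- V) \prod_(k <- nbrs j | k \notin V) (u (xi j) (xi k) * u (xi k) (xi j)).
  rewrite -big_split/= big_seq [RHS]big_seq; apply: eq_bigr => j jV.
  rewrite /pinned_field sE//; congr (_ * _); apply: eq_bigr => k kV.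
  by rewrite /xi (concat_out _ _ kV).
have -> : \prod_(j <- V) \prod_(k <- V) bond_weight u j k (s j) (s k) =
    \prod_(j <- V) \prod_(k <- V) bond_weight u j k (xi j) (xi k).
  rewrite big_seq [RHS]big_seq; apply: eq_bigr => j jV.
  by rewrite big_seq [RHS]big_seq; apply: eq_bigr => k kV; rewrite !sE.
ring.
Qed.

Variable mu : probability (config d) R.
Hypothesis mu_gibbs : gibbs_measures (softcore_family beta alpha) mu.
Local Notation nu := (evolve t mu).
Let o : config d := fun=> spin_zero.

Lemma softcore_pinned (V : {fset site d}) (w : config d) (v : {ffun V -> spin}) :
  softcore beta alpha V w (pinned V (concat_config v o)) =
  (softcore_weight beta alpha w v / softcore_partition beta alpha V w)%:E.
Proof.
rewrite /softcore (bigD1 v)//= big1 ?adde0.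
  rewrite diracE mem_set ?mule1//; exact/pinned_concat.
move=> v' v'v; rewrite diracE memNset ?mule0// => /pinned_concat e.
by move: v'v; rewrite e eqxx.
Qed.

(** The DLR equation of mu conditioned on the spins off V, for a cylinder
    event on V. *)
Lemma mu_pinned (V : {fset site d}) (v : {ffun V -> spin}) :
  mu (pinned V (concat_config v o)) =
  (\int[mu]_w (softcore_weight beta alpha w v / softcore_partition beta alpha V w)%:E)%E.
Proof.
have [_ h] := mu_gibbs V (measurable_pinned V (concat_config v o)).
have := h setT measurableT; rewrite setIT => <-.
by apply: eq_integral => w _; exact: softcore_pinned.
Qed.

(** Measurability is part of the assumption that mu is admitted by the
    soft-core family, so the explicit formula need not be examined. *)
Lemma measurable_softcore_weight (V : {fset site d}) (v : {ffun V -> spin}) :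
  measurable_fun [set: config d]
    (fun w => softcore_weight beta alpha w v / softcore_partition beta alpha V w).
Proof.
have [h _] := mu_gibbs V (measurable_pinned V (concat_config v o)).
apply/measurable_EFinP => _ B mB; have := h measurableT B mB.
rewrite !setTI => /sigma_field_sub; congr measurable.
by apply/seteqP; split => w /=; rewrite softcore_pinned.
Qed.

(** The conditional probability, given the initial spins w off V, that the
    spins at time t agree with z on V. *)
Definition cylinder_density (V : {fset site d}) (w z : config d) : R :=
  site_weight c V z * pinned_partition u q V w z / softcore_partition beta alpha V w.

Lemma cylinder_densityE (V : {fset site d}) w z : cylinder_density V w z =
  \sum_(v : {ffun V -> spin}) (\prod_(i <- V) transition t%:num (concat_config v o i) (z i)) *
     (softcore_weight beta alpha w v / softcore_partition beta alpha V w).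
Proof.
rewrite /cylinder_density -softcore_evolved mulr_suml; apply: eq_bigr => v _.
rewrite mulrAC mulrC; congr (_ * _).
by rewrite big_seq [RHS]big_seq; apply: eq_bigr => i iV; rewrite (concat_eq_in v w o iV).
Qed.

Let tr0 a b : 0 <= transition t%:num a b. Proof. exact: transition_ge0. Qed.

Let sw0 (V : {fset site d}) w (v : {ffun V -> spin}) :
  0 <= softcore_weight beta alpha w v / softcore_partition beta alpha V w.
Proof. by rewrite divr_ge0 ?softcore_weight_ge0// ltW// softcore_partition_gt0. Qed.

Lemma cylinder_density_ge0 V w z : 0 <= cylinder_density V w z.
Proof. by rewrite cylinder_densityE sumr_ge0// => v _; rewrite mulr_ge0// prodr_ge0. Qed.

Lemma measurable_cylinder_density V z : measurable_fun [set: config d] (cylinder_density V ^~ z).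
Proof.
rewrite (_ : cylinder_density V ^~ z = (fun w => \sum_(v : {ffun V -> spin})
  (\prod_(i <- V) transition t%:num (concat_config v o i) (z i)) *
     (softcore_weight beta alpha w v / softcore_partition beta alpha V w))); last first.
  by apply/funext => w; rewrite cylinder_densityE.
apply: measurable_sum => v; apply: measurable_funM; first exact: measurable_cst.
exact: measurable_softcore_weight.
Qed.

Lemma evolve_pinned V z : nu (pinned V z) = (\int[mu]_w (cylinder_density V w z)%:E)%E.
Proof.
rewrite /evolve.
transitivity (\int[mu]_w (\prod_(i <- V) transition t%:num (w i) (z i))%:E)%E.
  apply: eq_integral => w _.
  apply: (product_measureP (q := fun i => transition t%:num (w i))) => i.
    by move=> a; exact: tr0.
  exact: transition_sum1.
rewrite [LHS](ge0_integral_depends mu (V := V) o); last 2 first.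
- by move=> w /=; apply: prodr_ge0 => i _; exact: tr0.
- move=> w w' ww'; rewrite big_seq [RHS]big_seq; apply: eq_bigr => i iV.
  by rewrite (ww' i).
under [RHS]eq_integral do rewrite cylinder_densityE -sumEFin.
rewrite ge0_integral_sum//; last 2 first.
- move=> v; apply/measurable_EFinP; apply: measurable_funM; first exact: measurable_cst.
  exact: measurable_softcore_weight.
- by move=> v w _; rewrite lee_fin mulr_ge0// prodr_ge0.
apply: eq_bigr => v _; rewrite mu_pinned.
under [RHS]eq_integral do rewrite EFinM.
rewrite ge0_integralZl_EFin//.
- by move=> w _; rewrite lee_fin.
- by apply/measurable_EFinP; exact: measurable_softcore_weight.
- by rewrite prodr_ge0.
Qed.

(** Both integrals are averages over w, with weights 1 / N_V(w), of the sums in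
    the hypothesis.  An inequality in finite volume, for each boundary condition
    w, therefore passes to the evolved measure. *)
Lemma le_integral_evolve V (F G : config d -> R) :
  (forall w, 0 <= F w) -> (forall w, 0 <= G w) ->
  depends_on [set` V] F -> depends_on [set` V] G ->
  (forall w, sum_on V (fun s => site_weight c V s * pinned_partition u q V w s * F s) o <=
             sum_on V (fun s => site_weight c V s * pinned_partition u q V w s * G s) o) ->
  (\int[nu]_w (F w)%:E <= \int[nu]_w (G w)%:E)%E.
Proof.
have E (H : config d -> R) : (forall w, 0 <= H w) -> depends_on [set` V] H ->
    (\int[nu]_w (H w)%:E = \int[mu]_w
      (sum_on V (fun s => site_weight c V s * pinned_partition u q V w s * H s) o /
       softcore_partition beta alpha V w)%:E)%E.
  move=> H0 HV; rewrite (ge0_integral_depends _ o H0 HV).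
  transitivity (\int[mu]_w (\sum_(v : {ffun V -> spin})
      (H (concat_config v o) * cylinder_density V w (concat_config v o))%:E))%E.
    rewrite ge0_integral_sum//; last 2 first.
    - move=> v; apply/measurable_EFinP; apply: measurable_funM; first exact: measurable_cst.
      exact: measurable_cylinder_density.
    - by move=> v w _; rewrite lee_fin mulr_ge0// cylinder_density_ge0.
    apply: eq_bigr => v _.
    under [RHS]eq_integral do rewrite EFinM.
    rewrite ge0_integralZl_EFin//.
    - by rewrite -evolve_pinned.
    - by move=> w _; rewrite lee_fin cylinder_density_ge0.
    - by apply/measurable_EFinP; exact: measurable_cylinder_density.
  apply: eq_integral => w _; rewrite sumEFin; congr EFin.
  rewrite /sum_on mulr_suml; apply: eq_bigr => v _; rewrite /cylinder_density.
  by rewrite mulrC mulrAC.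
move=> F0 G0 FV GV FG; rewrite !E//.
have mS (H : config d -> R) : measurable_fun [set: config d] (fun w =>
  sum_on V (fun s => site_weight c V s * pinned_partition u q V w s * H s) o / softcore_partition beta alpha V w).
  rewrite (_ : (fun w => _) = (fun w => \sum_(v : {ffun V -> spin})
      cylinder_density V w (concat_config v o) * H (concat_config v o))); last first.
    by apply/funext => w; rewrite /sum_on mulr_suml; apply: eq_bigr => v _; rewrite /cylinder_density mulrAC.
  apply: measurable_sum => v; apply: measurable_funM; last exact: measurable_cst.
  exact: measurable_cylinder_density.
have S0 (H : config d -> R) : (forall w, 0 <= H w) -> forall w,
  0 <= sum_on V (fun s => site_weight c V s * pinned_partition u q V w s * H s) o / softcore_partition beta alpha V w.
  move=> H0 w; rewrite /sum_on mulr_suml sumr_ge0// => v _.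
  by rewrite mulrAC mulr_ge0// -/(cylinder_density V w (concat_config v o)) cylinder_density_ge0.
apply: ge0_le_integral => //.
- by move=> w _; rewrite lee_fin; exact: S0.
- by apply/measurable_EFinP; exact: mS.
- by apply/measurable_EFinP; exact: mS.
- move=> w _; rewrite lee_fin ler_wpM2r//.
  by rewrite invr_ge0 ltW// softcore_partition_gt0.
Qed.

End evolved_cylinders.

(** * The evolved measure is admitted by the limiting specification *)

Section dlr.
Context {R : realType} (d : nat) (beta : R) (alpha : probability spin R).
Context (t : {posnum R}) (eps : R).
Hypothesis beta_gt0 : 0 < beta.
Local Notation u := (half_bond beta).
Local Notation q := (posterior alpha t%:num).
Local Notation c := (evolved alpha t%:num).
Local Notation lam := (expR (- beta)).
Local Notation Dg := (2 * d)%N.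
Hypothesis eps_ge0 : 0 <= eps.
Hypothesis eps_small : 24 * Dg%:R * eps <= lam ^+ (6 * Dg).
Hypothesis q_small : forall a b b', b != b' -> q a b * q a b' <= eps.
Variable mu : probability (config d) R.
Hypothesis mu_gibbs : gibbs_measures (softcore_family beta alpha) mu.
Local Notation nu := (evolve t mu).
Let o : config d := fun=> spin_zero.

Let t_gt0 : 0 < t%:num. Proof. by []. Qed.
Let lam_le1 : lam <= 1.
Proof. by rewrite -[leRHS]expR0 ler_expR oppr_le0 ltW. Qed.
Let c_ge0 := evolved_ge0 alpha t_gt0.
Let c_sum1 := evolved_sum1 alpha t%:num.

Let Y n (w : config d) := pinned_partition u q (box d n) w.

Let Y_gt0 n w s : 0 < Y n w s.
Proof.
exact: (pinned_partition_gt0 (half_bond_gt0 beta) (expR_gt0 _) lam_le1 (half_bond_bnd beta_gt0)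
  (posterior_ge0 alpha t_gt0) (posterior_sum1 alpha _) q_small).
Qed.

Let Y_depends n w : depends_on [set` box d n] (Y n w).
Proof. by move=> s s' ss'; exact: eq_pinned_partition. Qed.

Let g_ex (D : {fset site d}) := finite_cond_lim (half_bond_gt0 beta) (expR_gt0 _) lam_le1
  (half_bond_bnd beta_gt0) eps_ge0 eps_small (posterior_ge0 alpha t_gt0)
  (posterior_sum1 alpha _) q_small c_ge0 c_sum1 D.

Let g (D : {fset site d}) := projT1 (cid (g_ex D)).
Let gP (D : {fset site d}) := projT2 (cid (g_ex D)).


Let mL (D : {fset site d}) A : measurable A -> measurable_fun [set: config d] (limit_avg g D \1_A).
Proof. by move=> mA; exact: (measurable_limit_avg Y_depends gP D mA). Qed.

Let ind1 A (s : config d) : `|\1_A s : R| <= 1.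
Proof. by rewrite indicE; case: (_ \in _); rewrite ?normr0 ?normr1. Qed.

Let ind0 A (s : config d) : 0 <= (\1_A s : R).
Proof. by rewrite indicE. Qed.

Let L0 (D : {fset site d}) A s : 0 <= limit_avg g D \1_A s.
Proof.
by apply: sumr_ge0 => v _; rewrite mulr_ge0//; exact: (limit_cond_ge0 c_ge0 c_sum1 Y_gt0 gP).
Qed.

Let Q0 n w (D : {fset site d}) A s : 0 <= cond_avg c (Y n w) D \1_A s.
Proof.
by apply: sumr_ge0 => v _; rewrite mulr_ge0//; exact: (finite_cond_ge0 c_ge0 c_sum1 (Y_gt0 n w)).
Qed.

Let depends_indic (M V : {fset site d}) z : (M `<=` V)%fset ->
  depends_on [set` V] (\1_(pinned M z) : config d -> R).
Proof.
move=> MV s s' ss'; rewrite !indicE; congr (_%:R); congr nat_of_bool.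
have e i : i \in M -> s i = s' i by move=> iM; apply: ss'; exact: (fsubsetP MV).
apply/idP/idP; rewrite !inE => h i iM; first by rewrite -e// h.
by rewrite e// h.
Qed.

Let integral_addc (F : config d -> R) (k : R) : 0 <= k -> (forall s, 0 <= F s) ->
  measurable_fun [set: config d] F ->
  (\int[nu]_w (F w + k)%:E = \int[nu]_w (F w)%:E + k%:E)%E.
Proof.
move=> k0 F0 mF; under eq_integral do rewrite EFinD.
rewrite ge0_integralD//; last first.
- exact/measurable_EFinP.
- by move=> w _; rewrite lee_fin.
rewrite integral_cst//; congr (_ + _)%E.
by rewrite [X in (_ * X)%E](_ : _ = 1%E) ?mule1//; exact: probability_setT.
Qed.

(** In a large box V the limiting average is within e of its finite-volume
    version, whatever the boundary condition, and the finite-volume version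
    satisfies the DLR equation exactly. *)
Lemma evolve_dlr_pinned (D M : {fset site d}) z :
  (\int[nu]_w (limit_avg g D \1_(pinned M z) w)%:E = nu (pinned M z))%E.
Proof.
set A := pinned M z; have mA : measurable A by exact: measurable_pinned.
have iA : (\int[nu]_w (\1_A w)%:E = nu A)%E by rewrite integral_indic// setIT.
(* three replacements, each of cost e: the limiting average by the average with
   boundary condition o, that one by the limiting average, and again by the
   average with boundary condition w *)
suff h (e : R) : 0 < e ->
    (\int[nu]_w (limit_avg g D \1_A w)%:E <= nu A + (3 * e)%:E /\
     nu A <= \int[nu]_w (limit_avg g D \1_A w)%:E + (3 * e)%:E)%E.
  have e3 (e : R) : 0 < e -> 0 < e / 3 by move=> e0; rewrite divr_gt0.
  have e3E (e : R) : 3 * (e / 3) = e by rewrite mulrC divfK.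
  apply/eqP; rewrite eq_le; apply/andP; split; apply/lee_addgt0Pr => e e0;
    by have [] := h _ (e3 e e0); rewrite e3E.
move=> e0; have [N cN] := limit_avg_close gP D e0.
have [N1 hN1] := sub_box (D `|` M)%fset.
have Nn := leq_maxl N N1; have := hN1 _ (leq_maxr N N1).
move: (maxn N N1) Nn => n Nn; rewrite fsubUset => /andP[DV MV] {N1 hN1}.
(* o is an arbitrary fixed boundary condition; Q o depends on finitely many spins *)
pose V := box d n; pose Q w := cond_avg c (Y n w) D \1_A.
have close w s : `|Q w s - limit_avg g D \1_A s| <= e.
  by rewrite -[leRHS]mulr1; apply: cN => // s'; exact: ind1.
have dA : depends_on [set` V] (\1_A : config d -> R) by exact: depends_indic.
have dQ : depends_on [set` V] (Q o).
  move=> s s' ss'; apply: eq_bigr => v _; congr (_ * _).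
    apply: (@finite_cond_depends R d c (Y n o) V D v (Y_depends o) s s') => i /=.
    by rewrite in_fsetD => /andP[_ iV]; exact: ss'.
  apply: dA => i /= iV; have [iD|iD] := boolP (i \in D).
    exact: concat_eq_in.
  by rewrite !concat_out//; exact: ss'.
have dadd (F : config d -> R) k : depends_on [set` V] F -> depends_on [set` V] (fun s => F s + k).
  by move=> dF s s' ss'; rewrite (dF s s').
have mQ : measurable_fun [set: config d] (Q o).
  by apply: (measurable_fun_depends (L := V)) dQ.
have mI : measurable_fun [set: config d] (\1_A : config d -> R) by exact: measurable_indic.
have SQ0 w : sum_on V (fun s => site_weight c V s * Y n w s * Q w s) o =
             sum_on V (fun s => site_weight c V s * Y n w s * \1_A s) o.
  exact: (sum_on_cond_avg c_ge0 c_sum1 (Y_gt0 n w)).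
have SQ w k : sum_on V (fun s => site_weight c V s * Y n w s * (Q w s + k)) o =
              sum_on V (fun s => site_weight c V s * Y n w s * (\1_A s + k)) o.
  have D1 F : sum_on V (fun s => site_weight c V s * Y n w s * (F s + k)) o =
      sum_on V (fun s => site_weight c V s * Y n w s * F s) o +
      sum_on V (fun s => site_weight c V s * Y n w s * k) o.
    by rewrite -big_split/=; apply: eq_bigr => v _; rewrite mulrDr.
  by rewrite !D1 SQ0.
have W0 w s : 0 <= site_weight c V s * Y n w s by exact: (joint_weight_ge0 c_ge0 (Y_gt0 n w)).
have e_ge0 := ltW e0.
split.
  apply: (@le_trans _ _ (\int[nu]_w (Q o w + e)%:E)%E).
    apply: ge0_le_integral => //.
    - by move=> w _; rewrite lee_fin L0.
    - by apply/measurable_EFinP; exact: mL.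
    - by apply/measurable_EFinP; apply: measurable_funD.
    - move=> w _; rewrite lee_fin; have /ler_normlP[a1 a2] := close o w; lra.
  apply: (@le_trans _ _ (\int[nu]_w (\1_A w + 3 * e)%:E)%E).
    apply: (le_integral_evolve mu_gibbs (V := V)).
    - by move=> w; rewrite addr_ge0// Q0.
    - by move=> w; rewrite addr_ge0// mulr_ge0.
    - exact: dadd.
    - exact: dadd.
    - move=> w; rewrite -[leRHS]SQ; apply: ler_sum => v _; apply: ler_wpM2l; first exact: W0.
      have /ler_normlP[a1 a2] := close o (concat_config v o).
      have /ler_normlP[b1 b2] := close w (concat_config v o).
      lra.
  by rewrite integral_addc ?iA// mulr_ge0.
rewrite -iA.
apply: (@le_trans _ _ (\int[nu]_w (Q o w + 2 * e)%:E)%E).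
  apply: (le_integral_evolve mu_gibbs (V := V)).
  - by move=> w; exact: ind0.
  - by move=> w; rewrite addr_ge0 ?Q0// mulr_ge0.
  - exact: dA.
  - exact: dadd.
  - move=> w; rewrite -[leLHS](SQ0 w); apply: ler_sum => v _; apply: ler_wpM2l; first exact: W0.
    have /ler_normlP[a1 a2] := close o (concat_config v o).
    have /ler_normlP[b1 b2] := close w (concat_config v o).
    lra.
rewrite -integral_addc ?mulr_ge0//; last exact: mL.
apply: ge0_le_integral => //.
- by move=> w _; rewrite lee_fin addr_ge0 ?Q0// mulr_ge0.
- by apply/measurable_EFinP; apply: measurable_funD.
- by apply/measurable_EFinP; apply: measurable_funD => //; exact: mL.
- move=> w _; rewrite lee_fin; have /ler_normlP[a1 a2] := close o w; lra.
Qed.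

Let K : kernel_family R d := limit_kernel g.
Let KE D eta A : K D eta A = (limit_avg g D \1_A eta)%:E.
Proof. exact: (limit_kernelE c_ge0 c_sum1 Y_gt0 gP). Qed.

(** Cylinder events are stable under intersection and generate the product
    sigma-algebra. *)
Lemma evolve_dlr (D : {fset site d}) A : measurable A ->
  (\int[nu]_w (K D w A) = nu A)%E.
Proof.
have mK B : measurable B -> measurable_fun [set: config d] (fun w => K D w B).
  move=> mB; rewrite (_ : (fun w => _) = (fun w => (limit_avg g D \1_B w)%:E)).
    by apply/measurable_EFinP; exact: mL.
  by apply/funext => w; rewrite KE.
pose P (B : set (config d)) : Prop := (\int[nu]_w (K D w B) = nu B)%E.
rewrite measurable_pinned_sets -/(P A); move: A.
apply: (@dynkin_induction _ (config d) (@pinned_sets d) P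
  (measurable_pinned_sets d) (@pinned_setsI d)); rewrite /P.
- under eq_integral do rewrite probability_setT.
  by rewrite integral_cst// mul1e.
- move=> _ [->|[M [z ->]]].
    by under eq_integral do rewrite measure0; rewrite integral0 measure0.
  by rewrite -(evolve_dlr_pinned D); apply: eq_integral => w _; rewrite KE.
- move=> S mS KS; have nuS : nu (~` S) = (1 - nu S)%E by exact: probability_setC.
  rewrite nuS -KS.
  have fin : (\int[nu]_w K D w S)%E \is a fin_num by rewrite KS; exact: fin_num_measure.
  have S1 : (\int[nu]_w K D w (~` S) + \int[nu]_w K D w S = 1)%E.
    rewrite -ge0_integralD//; last 2 first.
    - by apply: mK; exact: measurableC.
    - exact: mK.
    under eq_integral do rewrite addeC probability_setC// addeC subeK ?fin_num_measure//.
    by rewrite integral_cst// mul1e; exact: probability_setT.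
  by rewrite -S1 addeK.
- move=> F mF tF KF.
  have bigcupE (m : {measure set (config d) -> \bar R}) :
      m (\bigcup_k F k) = (\sum_(n <oo) m (F n))%E.
    by rewrite measure_bigcup//; apply: eq_eseriesl => n; rewrite in_setT.
  under eq_integral do rewrite bigcupE.
  rewrite bigcupE integral_nneseries//; last by move=> n; exact: mK.
  by apply: eq_eseriesr => n _; exact: KF.
Qed.

(** An event B determined by the spins off D factors out of the kernel, so the
    equation on B reduces to the one for A and B together. *)
Lemma evolve_is_gibbs : is_gibbs nu.
Proof.
exists K; split.
- exact: (limit_is_specification c_ge0 c_sum1 Y_gt0 Y_depends gP).
- exact: (limit_quasilocal c_ge0 c_sum1 Y_gt0 Y_depends gP).
have [sp1 sp2 sp3] := limit_is_specification c_ge0 c_sum1 Y_gt0 Y_depends gP.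
move=> D A mA; split; first exact: sp1.
move=> B mB; have mB' := sigma_field_sub mB.
apply: etrans _ (evolve_dlr D (measurableI _ _ mA mB')).
rewrite integral_mkcond; apply: eq_integral => w _.
have dB v : (\1_B (concat_config (v : {ffun D -> spin}) w) : R) = \1_B w.
  rewrite !indicE; congr (_%:R); congr nat_of_bool.
  by apply/idP/idP; rewrite !inE (sigma_field_depends mB (w' := w))// => i /= /negP iD;
    rewrite concat_out.
rewrite patchE !KE; have -> : limit_avg g D \1_(A `&` B) w = limit_avg g D \1_A w * \1_B w.
  rewrite /limit_avg mulr_suml; apply: eq_bigr => v _.
  by rewrite indicI /= dB mulrA.
by rewrite indicE; case: (w \in B); rewrite ?mulr1 ?mulr0.
Qed.

End dlr.

Theorem theorem2p14 (R : realType) (d : nat) (d_gt0 : (0 < d)%N)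
    (beta : R) (beta_gt0 : 0 < beta) (alpha : probability spin R) :
  exists2 t0 : R, 0 < t0 &
    forall mu : probability (config d) R,
      gibbs_measures (softcore_family beta alpha) mu ->
      forall t : {posnum R}, t%:num < t0 -> is_gibbs (evolve t mu).
Proof.
pose lam := expR (- beta).
(* the largest eps that the hypotheses of [ratio_decay] allow *)
pose eps : R := lam ^+ (6 * (2 * d)) / (24 * (2 * d)%:R).
have lam_gt0 : 0 < lam by exact: expR_gt0.
have D0 : 0 < 24 * (2 * d)%:R :> R by rewrite mulr_gt0// ltr0n muln_gt0.
have eps0 : 0 < eps by rewrite divr_gt0// exprn_gt0.
exists (eps * spin_weight_scale alpha / 2).
  by rewrite divr_gt0// mulr_gt0// spin_weight_scale_gt0.
move=> mu mu_gibbs t tt0.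
apply: (evolve_is_gibbs (eps := eps) beta_gt0 (ltW eps0) _ _ mu_gibbs).
  by rewrite /eps mulrC divfK// gt_eqF.
move=> a b b' /(posterior_small alpha [gt0 of t%:num] a) h; apply: le_trans h _.
rewrite ler_pdivrMr ?spin_weight_scale_gt0// mulrC -ler_pdivlMr//.
exact: ltW.
Qed.
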